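(* Let $H$ be an infinite dimensional complex Hilbert space and let $T \in \mathcal{AM}(H)$ be $\ast$-paranormal. Then $H = H_0 \oplus H_1 \oplus H_2$ and, with respect to this decomposition, $$T = \begin{pmatrix} V_0 & 0 & 0 \\ 0 & \lambda V & A \\ 0 & 0 & B \end{pmatrix},$$ where (1) $\sigma_{ess}(|T|) = \{\lambda\}$ with $\lambda \geq 0$; (2) $H_0 = \bigoplus_{i=1}^{n} N(|T| - \alpha_i I)$ is finite dimensional, where $(\lambda, \|T\|] \cap \sigma(|T|) = \{\alpha_i\}_{i=1}^{n}$ (the $\alpha_i$ distinct) for some $n \in \mathbb{N}$ (or this set is empty, in which case $H_0 = \{0\}$), $H_1 = N(|T| - \lambda I)$, and $H_2 = (H_0 \oplus H_1)^\perp$; (3) $V_0 = \bigoplus_{i=1}^{n} \alpha_i U_i$ is a finite rank normal operator, where $U_i \in \mathcal{B}(N(|T| - \alpha_i I))$ is unitary for each $i = 1, \dots, n$; (4) $V \in \mathcal{B}(H_1)$ is an isometry if $H_1 \neq \{0\}$, and $A \in \mathcal{B}(H_2, H_1)$, $B \in \mathcal{B}(H_2)$ are such that $V^*A = 0$, $A^*A + B^*B \leq \lambda^2 I_{H_2}$ and $(\lambda^4 + k^2) I_{H_2} - 2k BB^* \geq 0$ for all $k > 0$.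
   Context: $\mathcal{B}(H_1,H_2)$ denotes the bounded linear operators from $H_1$ to $H_2$, $\mathcal{B}(H)=\mathcal{B}(H,H)$, $N(\cdot)$ denotes the null space, and $|T| = (T^*T)^{1/2}$. An operator $T \in \mathcal{B}(H)$ is absolutely minimum attaining, written $T \in \mathcal{AM}(H)$, if for every nonzero closed subspace $L$ of $H$ there is a unit vector $x \in L$ with $\|Tx\| = m(T|_L)$, where $m(T|_L) = \inf\{\|Ty\| : y \in L, \|y\| = 1\}$. $T$ is $\ast$-paranormal if $\|T^*x\|^2 \leq \|T^2x\|\,\|x\|$ for all $x \in H$. The essential spectrum $\sigma_{ess}(S)$ of $S\in\mathcal{B}(H)$ is the spectrum of the image of $S$ in the Calkin algebra $\mathcal{B}(H)/\mathcal{K}(H)$, where $\mathcal{K}(H)$ is the ideal of compact operators. The spaces $H_0,H_1,H_2$ are closed subspaces of $H$, possibly finite dimensional or $\{0\}$; when one is $\{0\}$ the corresponding blocks are absent. *)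

(* Defs.v *)
From HB Require Import structures.
From mathcomp Require Import all_boot all_order all_algebra.
From mathcomp Require Import sesquilinear.
From mathcomp Require Import all_classical all_reals all_analysis.
From mathcomp Require Import complex.

Set Implicit Arguments.
Unset Strict Implicit.
Unset Printing Implicit Defensive.

Import Order.TTheory GRing.Theory Num.Theory.
Import numFieldNormedType.Exports.
Local Open Scope classical_set_scope.
Local Open Scope complex_scope.
Local Open Scope ring_scope.

(* The inner product is linear in its first argument and conjugate-linear in
   the second one. *)
HB.mixin Record isHilbert (R : realType) V & CompleteNormedModule R[i] V := {
  inner : {dot V for Num.conj} ;
  inner_norm : forall x : V, inner x x = `|x| ^+ 2 }.

#[short(type="hilbertType")]
HB.structure Definition Hilbert (R : realType) :=
  {V of isHilbert R V & CompleteNormedModule R[i] V}.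

(* The norm `|x| of the library lives in R[i] (as a nonnegative real complex
   number); rnorm is the same number, seen in R. *)
Definition rnorm (R : realType) (V : hilbertType R) (x : V) : R :=
  complex.Re `|x|.

Section RNorm.
Variables (R : realType) (V : hilbertType R).
Implicit Types x y : V.

Lemma rnormE x : `|x| = (rnorm x)%:C.
Proof. by rewrite /rnorm RRe_real// ger0_real. Qed.

Lemma rnorm_ge0 x : 0 <= rnorm x.
Proof. by rewrite -ler0c -rnormE. Qed.

Lemma rnormD x y : rnorm (x + y) <= rnorm x + rnorm y.
Proof. by rewrite -lecR rmorphD/= -!rnormE ler_normD. Qed.

Lemma rnormZ a x : rnorm (a *: x) = complex.Re `|a| * rnorm x.
Proof.
apply: (@complexI R); rewrite rmorphM/= -!rnormE normrZ; congr (_ * _).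
Qed.

Lemma rnormN x : rnorm (- x) = rnorm x.
Proof. by rewrite /rnorm normrN. Qed.

Lemma rnorm0 : rnorm (0 : V) = 0.
Proof. by rewrite /rnorm normr0. Qed.
End RNorm.

Section BoundedOperators.
Variable R : realType.

Record bop (V W : hilbertType R) := Bop {
  bop_fun :> V -> W ;
  bop_linear : linear bop_fun ;
  bop_bounded : exists M : R, forall x, rnorm (bop_fun x) <= M * rnorm x }.

HB.instance Definition _ (V W : hilbertType R) (S : bop V W) :=
  GRing.isLinear.Build R[i] V W *:%R (bop_fun S) (@bop_linear V W S).

HB.instance Definition _ (V W : hilbertType R) := gen_eqMixin (bop V W).
HB.instance Definition _ (V W : hilbertType R) := gen_choiceMixin (bop V W).

Lemma bopP (V W : hilbertType R) (S S' : bop V W) :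
  (forall x, S x = S' x) <-> S = S'.
Proof.
split=> [|->//]; case: S S' => [f fl fb] [g gl gb] /= /funext fg.
by subst g; congr Bop; exact: Prop_irrelevance.
Qed.

Section Module.
Variables V W : hilbertType R.

Let zero_linear : linear (fun _ : V => 0 : W).
Proof. by move=> a x y; rewrite scaler0 addr0. Qed.

Let zero_bounded :
  exists M : R, forall x : V, rnorm (0 : W) <= M * rnorm x.
Proof. by exists 0 => x; rewrite rnorm0 mul0r. Qed.

Definition bop0 : bop V W := Bop zero_linear zero_bounded.

Let opp_linear (S : bop V W) : linear (fun x => - S x).
Proof. by move=> a x y; rewrite linearP opprD scalerN. Qed.

Let opp_bounded (S : bop V W) :
  exists M : R, forall x, rnorm (- S x) <= M * rnorm x.
Proof. by have [M SM] := bop_bounded S; exists M => x; rewrite rnormN. Qed.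

Definition bop_opp (S : bop V W) : bop V W :=
  Bop (opp_linear S) (opp_bounded S).

Let add_linear (S S' : bop V W) : linear (fun x => S x + S' x).
Proof. by move=> a x y; rewrite !linearP scalerDr addrACA. Qed.

Let add_bounded (S S' : bop V W) :
  exists M : R, forall x, rnorm (S x + S' x) <= M * rnorm x.
Proof.
have [M SM] := bop_bounded S; have [M' SM'] := bop_bounded S'.
by exists (M + M') => x; rewrite (le_trans (rnormD _ _))// mulrDl lerD.
Qed.

Definition bop_add (S S' : bop V W) : bop V W :=
  Bop (add_linear S S') (add_bounded S S').

Let scale_linear (a : R[i]) (S : bop V W) : linear (fun x => a *: S x).
Proof. by move=> b x y; rewrite linearP scalerDr !scalerA mulrC. Qed.

Let scale_bounded (a : R[i]) (S : bop V W) :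
  exists M : R, forall x, rnorm (a *: S x) <= M * rnorm x.
Proof.
have [M SM] := bop_bounded S; exists (complex.Re `|a| * M) => x.
by rewrite rnormZ -mulrA ler_wpM2l// -ler0c RRe_real// ger0_real.
Qed.

Definition bop_scale (a : R[i]) (S : bop V W) : bop V W :=
  Bop (scale_linear a S) (scale_bounded a S).

Let addA : associative bop_add.
Proof. by move=> S S' S''; apply/bopP => x /=; rewrite addrA. Qed.
Let addC : commutative bop_add.
Proof. by move=> S S'; apply/bopP => x /=; rewrite addrC. Qed.
Let add0 : left_id bop0 bop_add.
Proof. by move=> S; apply/bopP => x /=; rewrite add0r. Qed.
Let addN : left_inverse bop0 bop_opp bop_add.
Proof. by move=> S; apply/bopP => x /=; rewrite addNr. Qed.
HB.instance Definition _ := GRing.isZmodule.Build (bop V W) addA addC add0 addN.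

Let scaleA a b S : bop_scale a (bop_scale b S) = bop_scale (a * b) S.
Proof. by apply/bopP => x /=; rewrite scalerA. Qed.
Let scale1 : left_id 1 bop_scale.
Proof. by move=> S; apply/bopP => x /=; rewrite scale1r. Qed.
Let scaleDr : right_distributive bop_scale +%R.
Proof. by move=> a S S'; apply/bopP => x /=; rewrite scalerDr. Qed.
Let scaleDl S : {morph bop_scale^~ S : a b / a + b}.
Proof. by move=> a b; apply/bopP => x /=; rewrite scalerDl. Qed.
HB.instance Definition _ :=
  GRing.Zmodule_isLmodule.Build R[i] (bop V W) scaleA scale1 scaleDr scaleDl.

End Module.

Lemma id_linear (V : hilbertType R) : linear (fun x : V => x).
Proof. by []. Qed.

Lemma id_bounded (V : hilbertType R) :
  exists M : R, forall x : V, rnorm x <= M * rnorm x.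
Proof. by exists 1 => x; rewrite mul1r. Qed.

Definition bop_id (V : hilbertType R) : bop V V :=
  Bop (@id_linear V) (@id_bounded V).

Lemma comp_linear (U V W : hilbertType R) (S : bop V W) (S' : bop U V) :
  linear (fun x => S (S' x)).
Proof. by move=> a x y; rewrite !linearP. Qed.

Lemma comp_bounded (U V W : hilbertType R) (S : bop V W) (S' : bop U V) :
  exists M : R, forall x, rnorm (S (S' x)) <= M * rnorm x.
Proof.
have [M SM] := bop_bounded S; have [M' SM'] := bop_bounded S'.
exists (`|M| * M') => x; rewrite (le_trans (SM _))//.
rewrite (@le_trans _ _ (`|M| * rnorm (S' x)))//.
  by rewrite ler_wpM2r ?rnorm_ge0// ler_norm.
by rewrite -mulrA ler_wpM2l.
Qed.

Definition bop_comp (U V W : hilbertType R) (S : bop V W) (S' : bop U V) :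
  bop U W := Bop (comp_linear S S') (comp_bounded S S').

Lemma bop_continuous (V W : hilbertType R) (S : bop V W) : continuous S.
Proof.
apply: bounded_linear_continuous; apply/linear_boundedP.
have [M SM] := bop_bounded S.
exists M%:C; split; first by apply/complex_realP; exists M.
move=> r Mr x; apply: (@le_trans _ _ (M%:C * `|x|)); last first.
  by rewrite ler_wpM2r// ltW.
by rewrite !rnormE -rmorphM/= lecR.
Qed.
End BoundedOperators.

Section ClosedSubspace.
Variables (R : realType) (H : hilbertType R).

Record csubspace := CSubspace {
  csub_pred :> {pred H} ;
  csub_submod : submod_closed csub_pred ;
  csub_closed : closed [set x | x \in csub_pred] }.

HB.instance Definition _ (L : csubspace) :=
  GRing.isSubmodClosed.Build R[i] H (csub_pred L)
    (GRing.submod_closed_semi (csub_submod L)).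
End ClosedSubspace.

Section Kernel.
Variables (R : realType) (V W : hilbertType R) (S : bop V W).

Let kernel_submod : submod_closed [pred x | S x == 0].
Proof.
split=> [|a x y]; rewrite !inE ?linear0// => /eqP x0 /eqP y0.
by rewrite bop_linear x0 y0 scaler0 addr0.
Qed.

Let kernel_closed : closed [set x | x \in [pred x | S x == 0]].
Proof.
rewrite (_ : [set _ | _] = S @^-1` [set 0]).
  apply: preimage_closed; first by move=> x _; exact: bop_continuous.
  exact/accessible_closed_set1/hausdorff_accessible/norm_hausdorff.
by apply/seteqP; split=> x /=; rewrite inE => /eqP.
Qed.

Definition null_space : csubspace V := CSubspace kernel_submod kernel_closed.
End Kernel.

(* A closed subspace seen as a Hilbert space of its own, with the structure
   induced by H. *)
Section SubHilbert.
Variables (R : realType) (H : hilbertType R) (L : csubspace H).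

Record subhilb := SubHilb { subhilb_val : H ; _ : subhilb_val \in csub_pred L }.

HB.instance Definition _ := [isSub of subhilb for subhilb_val].
HB.instance Definition _ := [Choice of subhilb by <:].
HB.instance Definition _ := [SubChoice_isSubLmodule of subhilb by <:].

Let subnorm (x : subhilb) : R[i] := `|val x|.

Let subnormD x y : subnorm (x + y) <= subnorm x + subnorm y.
Proof. exact: ler_normD. Qed.

Let subnormZ a x : subnorm (a *: x) = `|a| * subnorm x.
Proof. exact: normrZ. Qed.

Let subnorm0_eq0 x : subnorm x = 0 -> x = 0.
Proof. by move=> /normr0_eq0 x0; apply: val_inj. Qed.

HB.instance Definition _ :=
  Lmodule_isNormed.Build R[i] subhilb subnormD subnormZ subnorm0_eq0.

Lemma subhilb_normE (x : subhilb) : `|x| = `|val x|.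
Proof. by []. Qed.

Lemma subhilb_cauchy_cvg (F : set_system subhilb) :
  ProperFilter F -> cauchy F -> cvg F.
Proof.
move=> FF Fc.
have GF : ProperFilter (val @ F) by exact: fmap_proper_filter.
have Gc : cauchy (val @ F).
  apply/cauchy_exP => e e0; have /cauchyP/(_ e e0)[x Fx] := Fc.
  exists (val x); rewrite /fmap/=.
  by apply: filterS Fx => y; rewrite -!ball_normE.
have /cvg_ex[l Gl] := @cauchy_cvg H _ GF Gc.
have lL : l \in csub_pred L.
  apply: (closed_cvg _ (@csub_closed _ _ L) _ _ Gl).
  by apply: nearW => x; exact: valP.
apply/cvg_ex; exists (SubHilb lL).
apply/cvgrPdist_lt => e e0.
by move/cvgrPdist_lt : Gl => /(_ e e0).
Qed.

HB.instance Definition _ :=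
  Uniform_isComplete.Build subhilb subhilb_cauchy_cvg.

Definition subinner (x y : subhilb) : R[i] := inner (val x) (val y).

Let subinner_bilinear :
  bilinear_for (GRing.Scale.Law.clone _ _ ( *%R ) _)
    (GRing.Scale.Law.clone _ _ (Num.conj \; *%R) _) subinner.
Proof.
by split=> z a x y; [exact: linearPl | exact: linearPr].
Qed.
HB.instance Definition _ := bilinear_isBilinear.Build R[i] subhilb subhilb R[i]
    (GRing.Scale.Law.clone _ _ ( *%R ) _)
    (GRing.Scale.Law.clone _ _ (Num.conj \; *%R) _) subinner subinner_bilinear.
HB.instance Definition _ := isHermitianSesquilinear.Build R[i] subhilb false
  Num.conj subinner (fun x y => hermitian_subproof (val x) (val y)).
Let subinner_gt0 u : u != 0 -> 0 < subinner u u.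
Proof. by move=> u0; exact: neq0_dnorm_gt0. Qed.
HB.instance Definition _ := isDotProduct.Build R[i] subhilb subinner subinner_gt0.

Let subinner_norm x : (subinner : {dot subhilb for Num.conj}) x x = `|x| ^+ 2.
Proof. exact: inner_norm. Qed.
HB.instance Definition _ := isHilbert.Build R subhilb subinner_norm.
End SubHilbert.

Section Operators.
Variable R : realType.
Implicit Types V W H : hilbertType R.

(* The Hilbert space adjoint (it exists and is unique by the Riesz
   representation theorem). *)
Definition adj V W (S : bop V W) : bop W V :=
  xget (0 : bop W V) [set S' : bop W V | forall x y, inner (S x) y = inner x (S' y)].

Definition positive_bop H (S : bop H H) := forall x, 0 <= inner (S x) x.

Definition bop_le H (S S' : bop H H) := positive_bop (S' - S).

(* The positive square root; it exists and is unique when S is positive. *)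
Definition sqrt_bop H (S : bop H H) : bop H H :=
  xget (0 : bop H H) [set Q : bop H H | positive_bop Q /\ bop_comp Q Q = S].

Definition abs_bop H (T : bop H H) : bop H H := sqrt_bop (bop_comp (adj T) T).

Definition opnorm V W (S : bop V W) : R :=
  sup [set rnorm (S x) | x in [set x | rnorm x <= 1]].

Definition isometry_bop V W (S : bop V W) := forall x, rnorm (S x) = rnorm x.

Definition unitary_bop V W (S : bop V W) :=
  bop_comp (adj S) S = bop_id V /\ bop_comp S (adj S) = bop_id W.

Definition normal_bop H (S : bop H H) :=
  bop_comp (adj S) S = bop_comp S (adj S).

Definition finite_dimensional V (A : set V) := exists (n : nat) (e : 'I_n -> V),
  A = [set \sum_i c i *: e i | c in [set: 'I_n -> R[i]]].

Definition finite_rank V W (S : bop V W) := finite_dimensional (range S).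

Definition spectrum H (S : bop H H) : set R[i] :=
  [set z | ~ exists Q : bop H H,
    bop_comp (S - z *: bop_id H) Q = bop_id H /\
    bop_comp Q (S - z *: bop_id H) = bop_id H].

Definition compact_bop V W (S : bop V W) :=
  precompact (S @` [set x | rnorm x <= 1]).

(* S and S' have the same image in the Calkin algebra B(H) / K(H). *)
Definition calkin_eq H (S S' : bop H H) := compact_bop (S - S').

(* The spectrum in the Calkin algebra: z is in it iff the class of S - z has
   no inverse there. *)
Definition ess_spectrum H (S : bop H H) : set R[i] :=
  [set z | ~ exists Q : bop H H,
    calkin_eq (bop_comp (S - z *: bop_id H) Q) (bop_id H) /\
    calkin_eq (bop_comp Q (S - z *: bop_id H)) (bop_id H)].

(* m(T|_L). *)
Definition min_modulus H (T : bop H H) (L : csubspace H) : R :=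
  inf [set rnorm (T y) | y in [set y | y \in L /\ rnorm y = 1]].

Definition absolutely_min_attaining H (T : bop H H) :=
  forall L : csubspace H, (exists2 x, x \in L & x != 0) ->
  exists x, [/\ x \in L, rnorm x = 1 & rnorm (T x) = min_modulus T L].

Definition star_paranormal H (T : bop H H) :=
  forall x, rnorm (adj T x) ^+ 2 <= rnorm (T (T x)) * rnorm x.

Definition orthogonal_sets H (A B : set H) :=
  forall x y, A x -> B y -> inner x y = 0.

(* An internal orthogonal direct sum; an empty family gives L = {0}. *)
Definition is_dsum H (I : finType) (N : I -> csubspace H) (L : csubspace H) :=
  (forall i j, i != j -> orthogonal_sets [set` N i] [set` N j]) /\
  [set` L] = [set \sum_i val (x i) | x in [set: forall i, subhilb (N i)]].

(* S = \bigoplus_i Si, when L is the direct sum of the N i. *)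
Definition is_dsum_bop H (I : finType) (N : I -> csubspace H) (L : csubspace H)
    (Si : forall i, bop (subhilb (N i)) (subhilb (N i)))
    (S : bop (subhilb L) (subhilb L)) :=
  forall (x : forall i, subhilb (N i)) (y : subhilb L),
    val y = \sum_i val (x i) -> val (S y) = \sum_i val (Si i (x i)).

Definition is_dsum3 H (H0 H1 H2 : csubspace H) :=
  [/\ orthogonal_sets [set` H0] [set` H1],
      orthogonal_sets [set` H0] [set` H2],
      orthogonal_sets [set` H1] [set` H2] &
      forall x : H, exists (x0 : subhilb H0) (x1 : subhilb H1)
        (x2 : subhilb H2), x = val x0 + val x1 + val x2].

(* Sij is the block in row i and column j, that is, from Hj to Hi. *)
Definition block3 H (H0 H1 H2 : csubspace H) (T : bop H H)
    (S00 : bop (subhilb H0) (subhilb H0)) (S01 : bop (subhilb H1) (subhilb H0))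
    (S02 : bop (subhilb H2) (subhilb H0))
    (S10 : bop (subhilb H0) (subhilb H1)) (S11 : bop (subhilb H1) (subhilb H1))
    (S12 : bop (subhilb H2) (subhilb H1))
    (S20 : bop (subhilb H0) (subhilb H2)) (S21 : bop (subhilb H1) (subhilb H2))
    (S22 : bop (subhilb H2) (subhilb H2)) :=
  forall (x0 : subhilb H0) (x1 : subhilb H1) (x2 : subhilb H2),
    T (val x0 + val x1 + val x2) =
      val (S00 x0 + S01 x1 + S02 x2) +
      val (S10 x0 + S11 x1 + S12 x2) +
      val (S20 x0 + S21 x1 + S22 x2).
End Operators.

Notation "S ∘ S'" := (bop_comp S S') (at level 40, left associativity)
  : ring_scope.

(* Main.v *)
(* Write P = T^* T and let m be the supremum of the c such that
   |Tx|^2 >= c |x|^2 on a subspace of finite codimension.  By the minimum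
   attaining property |Tx|^2 <= m |x|^2 also holds on a subspace of finite
   codimension, so P - m, hence |T| - sqrt m, is compact: this gives the
   essential spectrum {sqrt m}.  Every nonzero closed P-invariant subspace
   contains an eigenvector of P (a minimiser of |Tx|), so P is diagonalisable,
   with finitely many eigenvalues above m, all of finite multiplicity, and
   |Tx|^2 <= c |x|^2 for x orthogonal to the eigenvectors of eigenvalue > c.
   Going down from the largest eigenvalue, *-paranormality makes each
   eigenspace above m invariant under T; T is there a multiple of an isometry
   of a finite dimensional space, thus of a unitary, and the eigenspace reduces
   T.  The eigenspace of m is invariant for the same reason, and the block
   inequalities express |Tx| <= sqrt m |x| on the complement of H_0. *)

Require Import Defs.
From mathcomp Require Import all_boot all_order all_algebra.
From mathcomp Require Import sesquilinear.
From mathcomp Require Import all_classical all_reals all_analysis.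
From mathcomp Require Import complex.
From mathcomp Require Import ring lra.

Set Implicit Arguments.
Unset Strict Implicit.
Unset Printing Implicit Defensive.

Import Order.TTheory GRing.Theory Num.Theory.
Import numFieldNormedType.Exports.
Local Open Scope classical_set_scope.
Local Open Scope complex_scope.
Local Open Scope ring_scope.

(** * The underlying real inner product *)

(** Apart from the square root defining |T|, no functional calculus enters. Eigenvectors come from
    one variational fact, [form_null]: where a form is nonnegative on a subspace L and vanishes at x
    in L, the operator sends x into the orthogonal complement of L. For P - b this turns minimisers
    of |Tx| into eigenvectors, for c - P it does so for maximal vectors. The descent has to start at
    the top because *-paranormality at T x involves T^3 x: the bound |Tx|^2 <= c |x|^2 holds only
    orthogonally to the higher eigenspaces, and that complement must already be invariant under T
    and its adjoint. Finite dimension, available only above m, is what makes T onto on an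
    eigenspace; at m an isometry may fail to be onto, whence the block A. The inequalities in k
    encode |adj B| <= lambda, since lambda^4 + k^2 - 2k B adj B = (lambda^2 - k)^2 + 2k (lambda^2 -
    B adj B). That bound follows from |adj T x|^2 <= |T^2 x| |x| <= lambda^2 |x|^2 on the complement
    of H_0. *)

Section RealInner.
Variables (R : realType) (V : hilbertType R).
Implicit Types x y z : V.

(** Real parts keep estimates inside an ordered field, within reach of [ring] and [lra]; complex
    identities are recovered by testing against 'i *: x as well. *)
Definition rdot x y : R := complex.Re (inner x y).

Lemma rdotC x y : rdot x y = rdot y x.
Proof.
have ReJ (z : R[i]) : complex.Re (Num.conj z) = complex.Re z by case: z.
by rewrite /rdot hermC expr0 mul1r; exact: ReJ.
Qed.

Lemma rdotDl x y z : rdot (x + y) z = rdot x z + rdot y z.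
Proof. by rewrite /rdot linearDl raddfD. Qed.

Lemma rdotDr x y z : rdot z (x + y) = rdot z x + rdot z y.
Proof. by rewrite !(rdotC z) rdotDl. Qed.

Lemma rdotNl x z : rdot (- x) z = - rdot x z.
Proof. by rewrite /rdot linearNl raddfN. Qed.

Lemma rdotNr x z : rdot z (- x) = - rdot z x.
Proof. by rewrite !(rdotC z) rdotNl. Qed.

Lemma rdotBl x y z : rdot (x - y) z = rdot x z - rdot y z.
Proof. by rewrite rdotDl rdotNl. Qed.

Lemma rdotBr x y z : rdot z (x - y) = rdot z x - rdot z y.
Proof. by rewrite rdotDr rdotNr. Qed.

Lemma rdotZl (a : R) x z : rdot (a%:C *: x) z = a * rdot x z.
Proof.
by rewrite /rdot linearZl_LR/=; case: (inner x z) => u v /=; rewrite mul0r subr0.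
Qed.

Lemma rdotZr (a : R) x z : rdot z (a%:C *: x) = a * rdot z x.
Proof. by rewrite !(rdotC z) rdotZl. Qed.

Lemma rdot0l z : rdot 0 z = 0.
Proof. by rewrite /rdot linear0l. Qed.

Lemma rdot0r z : rdot z 0 = 0.
Proof. by rewrite rdotC rdot0l. Qed.

Lemma rdot_suml (I : Type) (r : seq I) (P : pred I) (F : I -> V) z :
  rdot (\sum_(i <- r | P i) F i) z = \sum_(i <- r | P i) rdot (F i) z.
Proof.
by elim/big_rec2: _ => [|i y1 y2 _ <-]; rewrite ?rdot0l ?rdotDl.
Qed.

Lemma rdotxx x : rdot x x = rnorm x ^+ 2.
Proof. by rewrite /rdot inner_norm rnormE -rmorphXn. Qed.

Lemma rdot_ge0 x : 0 <= rdot x x.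
Proof. by rewrite rdotxx sqr_ge0. Qed.

Lemma inner_xx x : inner x x = (rnorm x ^+ 2)%:C.
Proof. by rewrite inner_norm rnormE -rmorphXn. Qed.

Lemma rnorm_eq0 x : (rnorm x == 0) = (x == 0).
Proof.
by rewrite -(inj_eq (@complexI R)) -rnormE normr_eq0.
Qed.

Lemma rnorm_gt0 x : (0 < rnorm x) = (x != 0).
Proof. by rewrite lt_neqAle rnorm_ge0 andbT eq_sym rnorm_eq0. Qed.

Lemma rnormZR (a : R) x : 0 <= a -> rnorm (a%:C *: x) = a * rnorm x.
Proof. by move=> a0; rewrite rnormZ ger0_norm ?ler0c. Qed.

Lemma rnormB x y : rnorm (x - y) = rnorm (y - x).
Proof. by rewrite -rnormN opprB. Qed.

Lemma inner_Im x y : complex.Im (inner x y) = - rdot ('i *: x) y.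
Proof.
by rewrite /rdot linearZl_LR/=; case: (inner x y) => u v /=; rewrite mul0r mul1r sub0r opprK.
Qed.

Lemma innerE x y : inner x y = (rdot x y) +i* (- rdot ('i *: x) y).
Proof. by rewrite -inner_Im /rdot; case: (inner x y). Qed.

Lemma inner_eq0 x y : rdot x y = 0 -> rdot ('i *: x) y = 0 -> inner x y = 0.
Proof. by rewrite innerE => -> ->; rewrite oppr0. Qed.

Lemma inner0_rdot x y : inner x y = 0 -> rdot x y = 0.
Proof. by rewrite /rdot => ->. Qed.

Lemma innerC x y : inner y x = Num.conj (inner x y).
Proof. by rewrite hermC expr0 mul1r. Qed.

Lemma inner0C x y : inner x y = 0 -> inner y x = 0.
Proof. by move=> xy; rewrite innerC xy conjC0. Qed.

Lemma rdot_form (t : R) x y :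
  rdot (x + t%:C *: y) (x + t%:C *: y)
  = rdot x x + 2 * t * rdot x y + t ^+ 2 * rdot y y.
Proof. rewrite !(rdotDl, rdotDr, rdotZl, rdotZr) (rdotC y x); ring. Qed.

Lemma rnormD2 x y :
  rnorm (x + y) ^+ 2 = rnorm x ^+ 2 + 2 * rdot x y + rnorm y ^+ 2.
Proof. by rewrite -!rdotxx !(rdotDl, rdotDr) (rdotC y x); ring. Qed.

Lemma rnormB2 x y :
  rnorm (x - y) ^+ 2 = rnorm x ^+ 2 - 2 * rdot x y + rnorm y ^+ 2.
Proof. by rewrite rnormD2 rdotNr rnormN; ring. Qed.

Lemma quad_ge0_lin0 (a b : R) :
  (forall t, 0 <= 2 * t * a + t ^+ 2 * b) -> a = 0.
Proof.
move=> h; have b0 : 0 <= b.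
  have := h 1; have := h (-1); rewrite !mulr1 sqrrN !expr1n => h1 h2; lra.
have b1 : 0 < b + 1 by lra.
(* The minimiser is -a/b; b + 1 in place of b keeps the denominator positive when b = 0. *)
have := h (- a / (b + 1)).
have -> : 2 * (- a / (b + 1)) * a + (- a / (b + 1)) ^+ 2 * b
  = - (a ^+ 2 * ((b + 2) / (b + 1) ^+ 2)).
  by field; rewrite gt_eqF.
rewrite oppr_ge0 => h1.
have c0 : 0 < (b + 2) / (b + 1) ^+ 2 by rewrite divr_gt0 ?exprn_gt0//; lra.
have : a ^+ 2 <= 0 by rewrite -(pmulr_lle0 _ c0).
by move=> a2; apply/eqP; rewrite -sqrf_eq0 eq_le a2 sqr_ge0.
Qed.

Lemma rdot_le x y : rdot x y <= rnorm x * rnorm y.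
Proof.
have [->|y0] := eqVneq y 0; first by rewrite rdot0r rnorm0 mulr0.
have ny : 0 < rnorm y by rewrite rnorm_gt0.
have := rdot_ge0 ((rnorm y)%:C *: x + (- rnorm x)%:C *: y).
rewrite !(rdotDl, rdotDr, rdotZl, rdotZr) (rdotC y x) !rdotxx => h.
have [x0|nx] := eqVneq (rnorm x) 0.
  by move/eqP : x0; rewrite rnorm_eq0 => /eqP ->; rewrite rdot0l rnorm0 mul0r.
have nx0 : 0 < rnorm x by rewrite lt_neqAle eq_sym nx rnorm_ge0.
have h2 : 0 <= 2 * (rnorm x * rnorm y) * (rnorm x * rnorm y - rdot x y).
  by move: h; congr (_ <= _); ring.
rewrite -subr_ge0 -(pmulr_rge0 _ (_ : 0 < 2 * (rnorm x * rnorm y)))//.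
by rewrite !mulr_gt0.
Qed.

Lemma ler_rdot x y : `|rdot x y| <= rnorm x * rnorm y.
Proof.
by rewrite ler_norml rdot_le andbT lerNl -rdotNl (le_trans (rdot_le _ _))// rnormN.
Qed.

Lemma rnorm_le_dual x (c : R) : 0 <= c ->
  (forall y, rdot x y <= c * rnorm y) -> rnorm x <= c.
Proof.
move=> c0 /(_ x); rewrite rdotxx expr2.
have [->|x0] := eqVneq x 0; first by rewrite rnorm0.
by rewrite ler_pM2r// rnorm_gt0.
Qed.

Lemma unit_scale x : x != 0 -> rnorm ((rnorm x)^-1%:C *: x) = 1.
Proof.
move=> x0; rewrite rnormZR ?invr_ge0 ?rnorm_ge0// mulVf//.
by rewrite rnorm_eq0.
Qed.

Lemma pythagoras (I : finType) (P : pred I) (F : I -> V) :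
  (forall i j, i != j -> rdot (F i) (F j) = 0) ->
  rnorm (\sum_(i | P i) F i) ^+ 2 = \sum_(i | P i) rnorm (F i) ^+ 2.
Proof.
move=> h; rewrite -rdotxx rdot_suml; apply: eq_bigr => i Pi.
rewrite rdotC rdot_suml (bigD1 i)//= rdotxx big1 ?addr0// => j /andP[_ ji].
exact: h.
Qed.

End RealInner.

Section RealScalars.
Variables (R : realType) (V W : hilbertType R).

Lemma bopZ (S : bop V W) (a : R[i]) x : S (a *: x) = a *: S x.
Proof. by rewrite linearZ. Qed.

Lemma bopD (S : bop V W) x y : S (x + y) = S x + S y.
Proof. by rewrite linearD. Qed.

Lemma bopB (S : bop V W) x y : S (x - y) = S x - S y.
Proof. by rewrite linearB. Qed.

Lemma bop0E (S : bop V W) : S 0 = 0.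
Proof. by rewrite linear0. Qed.

Lemma bop_sum (I : Type) (r : seq I) (P : pred I) (S : bop V W) (F : I -> V) :
  S (\sum_(i <- r | P i) F i) = \sum_(i <- r | P i) S (F i).
Proof. by rewrite linear_sum. Qed.

Lemma bop_gt0_bounded (S : bop V W) :
  exists2 M : R, 0 < M & forall x, rnorm (S x) <= M * rnorm x.
Proof.
have [M h] := bop_bounded S; exists (`|M| + 1); first by rewrite ltr_wpDl.
move=> x; rewrite (le_trans (h x))// ler_wpM2r ?rnorm_ge0//.
by rewrite (le_trans (ler_norm _))// lerDl.
Qed.

End RealScalars.

(** * Projections, adjoints and inverses *)

Section Completeness.
Variables (R : realType) (V : hilbertType R).
Implicit Types (x y : V) (L : csubspace V).

Lemma gt0_complex (e : R[i]) : 0 < e -> exists2 r : R, 0 < r & e = r%:C.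
Proof.
move=> e0; exists (complex.Re e); last by rewrite RRe_real// gtr0_real.
by rewrite -ltcR RRe_real// gtr0_real.
Qed.

Lemma cauchy_seq_limit (u : nat -> V) :
  (forall e : R, 0 < e -> exists N, forall m n, (N <= m)%N -> (N <= n)%N ->
     rnorm (u m - u n) < e) ->
  exists l, forall e : R, 0 < e -> exists N, forall n, (N <= n)%N ->
     rnorm (u n - l) < e.
Proof.
move=> uc; have /cauchy_cvg/cvg_ex[l ul] : cauchy (u @ \oo).
  apply/cauchy_exP => e /gt0_complex[r r0 ->].
  have [N uN] := uc r r0; exists (u N).
  exists N => // n /= Nn; rewrite -ball_normE /= rnormE ltcR.
  exact: uN.
exists l => e e0; have /cvgrPdist_lt/(_ e%:C) := ul.
rewrite ltcR => /(_ e0)[N _ h]; exists N => n Nn.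
by have := h n Nn; rewrite rnormE ltcR rnormB.
Qed.

Lemma closed_of_dist (P : set V) :
  (forall l, (forall e : R, 0 < e -> exists2 y, P y & rnorm (y - l) < e) -> P l) ->
  closed P.
Proof.
move=> h l lP; apply: h => e e0.
have : nbhs l (ball l e%:C) by apply: nbhsx_ballx; rewrite ltcR.
move=> /lP[y [Py]]; rewrite -ball_normE /= rnormE ltcR => ly.
by exists y => //; rewrite rnormB.
Qed.

Lemma closed_dist (P : set V) : closed P ->
  forall l, (forall e : R, 0 < e -> exists2 y, P y & rnorm (y - l) < e) -> P l.
Proof.
move=> Pc l h; apply: Pc => B /nbhs_ballP[e /= e0 eB].
have [r r0 er] := gt0_complex e0.
have [y Py ly] := h r r0; exists y; split=> //; apply: eB.
by rewrite -ball_normE /= rnormE er ltcR rnormB.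
Qed.

Lemma csub_dist L l :
  (forall e : R, 0 < e -> exists2 y, y \in L & rnorm (y - l) < e) -> l \in L.
Proof.
move=> h; apply: (closed_dist (@csub_closed _ _ L)) => e /h[y yL ly].
by exists y.
Qed.

Lemma csub_exists (P : set V) : P 0 ->
  (forall a x y, P x -> P y -> P (a *: x + y)) ->
  (forall l, (forall e : R, 0 < e -> exists2 y, P y & rnorm (y - l) < e) -> P l) ->
  exists L : csubspace V, forall x, x \in L <-> P x.
Proof.
move=> P0 Pl Pc.
have sub : submod_closed [pred x | `[< P x >]].
  split; first exact/asboolP.
  by move=> a x y /asboolP Px /asboolP Py; apply/asboolP/Pl.
have cl : closed [set x | x \in [pred x | `[< P x >]]].
  rewrite (_ : [set _ | _] = P); first exact: closed_of_dist.
  by apply/seteqP; split=> x /= /asboolP.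
by exists (CSubspace sub cl) => x; split=> /asboolP.
Qed.

(** L is a complex subspace, so i y is in L along with y and the imaginary part vanishes too. *)
Lemma csub_rdot_inner L x : (forall y, y \in L -> rdot x y = 0) ->
  forall y, y \in L -> inner x y = 0.
Proof.
move=> h y yL; apply: inner0C; apply: inner_eq0; rewrite rdotC; apply: h => //.
by rewrite rpredZ.
Qed.

(** Serves the closedness clause of [csub_exists] for conditions given by Lipschitz functions; the
    sign of [c] is free, hence the |c| + 1 in the proof. *)
Lemma csub_dist_approx (P : set V) (f : V -> R) (c : R) :
  (forall x y, f x <= f y + c * rnorm (x - y)) ->
  (forall y, P y -> f y <= 0) ->
  forall l, (forall e : R, 0 < e -> exists2 y, P y & rnorm (y - l) < e) -> f l <= 0.
Proof.
move=> fc fP l h; apply/ler_addgt0Pl => e e0; rewrite addr0.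
have [y Py ly] := h (e / (`|c| + 1)) (divr_gt0 e0 (ltr_wpDl (normr_ge0 _) ltr01)).
apply: (le_trans (fc l y)); rewrite -[e]add0r lerD ?fP//.
rewrite rnormB (@le_trans _ _ ((`|c| + 1) * rnorm (y - l)))//.
  by rewrite ler_wpM2r ?rnorm_ge0// (le_trans (ler_norm _))// lerDl.
by rewrite mulrC -ler_pdivlMr ?ltW// ltr_wpDl.
Qed.

End Completeness.

Section Projection.
Variables (R : realType) (V : hilbertType R).
Implicit Types (x y : V) (L : csubspace V).

(** A sequence in L minimising the distance to x is Cauchy; varying its limit p along y gives
    orthogonality. *)
Lemma projection L x :
  exists p, p \in L /\ forall y, y \in L -> rdot (x - p) y = 0.
Proof.
pose D := [set rnorm (x - y) | y in [set` L]].
have D0 : D !=set0 by exists (rnorm (x - 0)); exists 0 => //=; exact: rpred0.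
have Dlb : lbound D 0 by move=> _ [y _ <-]; exact: rnorm_ge0.
have hiD : has_inf D by split=> //; exists 0.
set d := inf D.
have dle y : y \in L -> d <= rnorm (x - y).
  by move=> yL; apply: ge_inf; [exists 0|exists y].
have d0 : 0 <= d by exact: lb_le_inf.
have /choice[u uP] : forall n : nat, exists y, y \in L /\ rnorm (x - y) < d + n.+1%:R^-1.
  move=> n; have n0 : 0 < n.+1%:R^-1 :> R by rewrite invr_gt0.
  by have [_ [y yL <-] h] := inf_adherent n0 hiD; exists y.
(* Parallelogram law: the midpoint of y and z lies in L, hence at distance at least d from x. *)
have key y z : y \in L -> z \in L ->
    rnorm (y - z) ^+ 2 <= 2 * rnorm (x - y) ^+ 2 + 2 * rnorm (x - z) ^+ 2 - 4 * d ^+ 2.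
  move=> yL zL.
  have mL : (2^-1)%:C *: (y + z) \in L by rewrite rpredZ// rpredD.
  have := dle _ mL => h.
  have : d ^+ 2 <= rnorm (x - (2^-1)%:C *: (y + z)) ^+ 2.
    by rewrite lerXn2r// nnegrE ?rnorm_ge0.
  rewrite -!rdotxx !(rdotDl,rdotDr,rdotNl,rdotNr,rdotZl,rdotZr).
  rewrite (rdotC y x) (rdotC z x) (rdotC z y) => hh; lra.
have uc : forall e : R, 0 < e -> exists N, forall m n, (N <= m)%N -> (N <= n)%N ->
     rnorm (u m - u n) < e.
  move=> e e0.
  (* For s = 1/(j+1) one has (d + s)^2 - d^2 <= (2d + 1) s, and j > k makes this less than e^2/4;
     [key] then bounds the squared distance by e^2. *)
  pose k : R := 4 * (2 * d + 1) / e ^+ 2.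
  have k0 : 0 <= k by rewrite divr_ge0 ?sqr_ge0// mulr_ge0//; lra.
  exists (Num.truncn k).+1 => m n Nm Nn.
  have kN j : (Num.truncn k < j)%N -> j.+1%:R^-1 * k < 1.
    move=> Nj; rewrite mulrC ltr_pdivrMr// mul1r.
    rewrite (lt_le_trans (truncnS_gt k))// ler_nat; exact: leqW.
  have step j : (Num.truncn k < j)%N ->
      rnorm (x - u j) ^+ 2 - d ^+ 2 < e ^+ 2 / 4.
    move=> Nj; have [uL h] := uP j.
    have s0 : 0 < j.+1%:R^-1 :> R by rewrite invr_gt0.
    have s1 : j.+1%:R^-1 <= 1 :> R by rewrite invf_le1// ler1n.
    have h1 : rnorm (x - u j) ^+ 2 < (d + j.+1%:R^-1) ^+ 2.
      by rewrite ltrXn2r// ?nnegrE ?rnorm_ge0//; lra.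
    have h2 := kN _ Nj.
    set s := j.+1%:R^-1 in s0 s1 h1 h2 *.
    have h3 : s * (4 * (2 * d + 1)) < e ^+ 2.
      by move: h2; rewrite /k mulrA ltr_pdivrMr ?exprn_gt0// mul1r.
    have h4 : s * s <= s by rewrite ler_piMr// ltW.
    have -> : e ^+ 2 / 4 = e * e / 4 by rewrite expr2.
    by move: h1 h3; rewrite !expr2 => h1 h3; lra.
  have [uLm _] := uP m; have [uLn _] := uP n.
  have := key _ _ uLm uLn; have := step _ Nm; have := step _ Nn => s1 s2 s3.
  rewrite -(@ltr_pXn2r _ 2)// ?nnegrE ?rnorm_ge0// ?ltW//; lra.
have [p pP] := cauchy_seq_limit uc.
have pL : p \in L.
  apply: csub_dist => e e0; have [N h] := pP e e0.
  by exists (u N); [have [] := uP N|exact: h].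
have xp : rnorm (x - p) <= d.
  apply/ler_addgt0Pl => e e0.
  have e2 : 0 < e / 2 by rewrite divr_gt0.
  have [N h] := pP _ e2.
  pose n := maxn N (Num.truncn (2 / e)).
  have [_ un] := uP n.
  have : rnorm (u n - p) < e / 2 by apply: h; exact: leq_maxl.
  have : n.+1%:R^-1 < e / 2 :> R.
    rewrite -[e / 2]invrK invf_div ltf_pV2 ?posrE ?divr_gt0//.
    by rewrite (lt_le_trans (truncnS_gt _))// ler_nat ltnS leq_maxr.
  move=> h1 h2; have -> : x - p = (x - u n) + (u n - p) by rewrite subrKA.
  apply: (le_trans (rnormD _ _)).
  move: un h1 h2; move: (rnorm (x - _)) (rnorm (_ - p)) (n.+1%:R^-1) => a b c.
  lra.
exists p; split=> // y yL; apply: (@quad_ge0_lin0 _ _ (rdot y y)) => t.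
have := dle (p + (- t)%:C *: y); rewrite rpredD// ?rpredZ// => /(_ isT) h.
have h0 : rnorm (x - p) ^+ 2 <= rnorm (x - (p + (- t)%:C *: y)) ^+ 2.
  by rewrite lerXn2r// ?nnegrE ?rnorm_ge0// (le_trans xp).
have := h0; rewrite -(rdotxx (x - p)).
have -> : x - (p + (- t)%:C *: y) = (x - p) + t%:C *: y.
  by rewrite opprD addrA rmorphN scaleNr opprK.
by rewrite -rdotxx rdot_form -addrA lerDl.
Qed.

Lemma csub_eq_of_perp0 L (M : csubspace V) :
  (forall x, x \in L -> x \in M) ->
  (forall x, x \in M -> (forall y, y \in L -> rdot x y = 0) -> x = 0) ->
  forall x, x \in M -> x \in L.
Proof.
move=> LM h x xM; have [p [pL xp]] := projection L x.
have : x - p = 0 by apply: h => //; rewrite rpredB// LM.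
by move/eqP; rewrite subr_eq0 => /eqP ->.
Qed.

End Projection.

Section Orthogonality.
Variables (R : realType) (V : hilbertType R).
Implicit Types (x y : V) (L : csubspace V).

Lemma rdot0_dist (P : set V) y l : (forall z, P z -> rdot z y = 0) ->
  (forall e : R, 0 < e -> exists2 z, P z & rnorm (z - l) < e) -> rdot l y = 0.
Proof.
move=> Py ld; apply/eqP; rewrite -normr_le0.
apply: (csub_dist_approx (f := fun z => `|rdot z y|) (c := rnorm y) _ _ ld).
  move=> a b; rewrite -{1}(subrK b a) rdotDl addrC (le_trans (ler_normD _ _))//.
  by rewrite lerD2l mulrC ler_rdot.
by move=> z /Py ->; rewrite normr0.
Qed.

Lemma rdotiZ x y : rdot ('i *: x) ('i *: y) = rdot x y.
Proof.
rewrite -[LHS]opprK -inner_Im linearZr_LR /= innerE /=.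
by rewrite mul0r mulN1r add0r opprK.
Qed.

Lemma rdotiC x y : rdot ('i *: x) y = - rdot x ('i *: y).
Proof.
by rewrite -(rdotiZ x) scalerA -expr2 sqr_i scaleN1r rdotNr opprK.
Qed.

Lemma orthogonal_csub (A : set V) :
  exists L, forall x, x \in L <-> forall y, A y -> inner x y = 0.
Proof.
apply: csub_exists => [y _|a x z xA zA y Ay|l ld y Ay].
- by rewrite linear0l.
- by rewrite linearPl /= xA// zA// mulr0 addr0.
- apply: inner_eq0; first apply: (rdot0_dist _ ld) => z /(_ y Ay).
    exact: inner0_rdot.
  rewrite rdotiC; apply/eqP; rewrite oppr_eq0; apply/eqP.
  apply: (rdot0_dist _ ld) => z /(_ y Ay) zy.
  by apply: inner0_rdot; rewrite linearZr_LR /= zy mulr0.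
Qed.

Lemma csubI L (M : csubspace V) :
  exists K : csubspace V, forall x, x \in K <-> x \in L /\ x \in M.
Proof.
apply: csub_exists => [|a x y [xL xM] [yL yM]|l ld].
- by split; exact: rpred0.
- by split; rewrite rpredD// rpredZ.
- by split; apply: csub_dist => e /ld[y [yL yM]]; exists y.
Qed.

Lemma rnorm0_rdot x : (forall y, rdot x y = 0) -> x = 0.
Proof.
by move=> /(_ x) /eqP; rewrite rdotxx expf_eq0 /= rnorm_eq0 => /eqP.
Qed.

Lemma rdot_inj x y : (forall z, rdot z x = rdot z y) -> x = y.
Proof.
move=> h; apply/eqP; rewrite -subr_eq0; apply/eqP/rnorm0_rdot => z.
by rewrite rdotC rdotBr h subrr.
Qed.

End Orthogonality.

Section Adjoint.
Variable R : realType.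
Implicit Types V W : hilbertType R.

(** Riesz representation of x -> <Sx, y>: a vector r orthogonal to the kernel, but outside it,
    represents the functional up to a scalar. *)
Lemma riesz_bop V W (S : bop V W) (y : W) :
  exists v, forall x, inner (S x) y = inner x v.
Proof.
have [M M0 SM] := bop_gt0_bounded S.
have [K KP] : exists K : csubspace V, forall x, x \in K <-> inner (S x) y = 0.
  have lim P l (z : W) : (forall x, P x -> rdot (S x) z = 0) ->
     (forall e : R, 0 < e -> exists2 x, P x & rnorm (x - l) < e) ->
     rdot (S l) z = 0.
    move=> Pz ld; apply: (rdot0_dist (P := S @` P)).
      by move=> _ [x Px <-]; exact: Pz.
    move=> e e0; have [x Px xl] := ld (e / M) (divr_gt0 e0 M0).
    exists (S x); first by exists x.
    by rewrite -bopB (le_lt_trans (SM _))// mulrC -ltr_pdivlMr.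
  apply: csub_exists => [|a x z hx hz|l ld].
  - by rewrite linear0 linear0l.
  - by rewrite linearP linearPl /= hx hz mulr0 addr0.
  - apply: inner_eq0; first by apply: (lim _ _ _ _ ld) => x /inner0_rdot.
    rewrite rdotiC; apply/eqP; rewrite oppr_eq0; apply/eqP.
    apply: (lim _ _ _ _ ld) => x xy.
    by apply: inner0_rdot; rewrite linearZr_LR /= xy mulr0.
have [allK|/existsNP[x0 x0K]] := pselect (forall x, x \in K).
  by exists 0 => x; rewrite linear0r; apply/KP.
have [p [pK pP]] := projection K x0; set r := x0 - p in pP.
have fr : inner (S r) y != 0.
  apply/eqP => fr; apply: x0K; apply/KP.
  by rewrite -[x0](subrK p) linearD linearDl /= fr (KP p).1// addr0.
have r0 : inner r r != 0.
  apply: contra_neq fr; rewrite inner_xx => /complexI /eqP.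
  by rewrite expf_eq0 /= rnorm_eq0 => /eqP ->; rewrite linear0 linear0l.
exists (Num.conj (inner (S r) y / inner r r) *: r) => x.
rewrite linearZr_LR /=.
(* For f(x) = <Sx, y>, the vector f(r) x - f(x) r is in the kernel of f, to which r is
   orthogonal. *)
have : inner r (inner (S r) y *: x - inner (S x) y *: r) = 0.
  apply: (csub_rdot_inner pP); apply/KP.
  by rewrite bopB !bopZ linearBl !linearZl_LR /= mulrC subrr.
move=> /inner0C; rewrite linearBl !linearZl_LR /= => /eqP; rewrite subr_eq0 => /eqP h.
by rewrite conjCK mulrAC h mulfK.
Qed.

Lemma inner_eq_rdot V (x y u v : V) : rdot x y = rdot u v ->
  rdot ('i *: x) y = rdot ('i *: u) v -> inner x y = inner u v.
Proof. by move=> h1 h2; rewrite !innerE h1 h2. Qed.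

Lemma adj_exists V W (S : bop V W) :
  exists S' : bop W V, forall x y, inner (S x) y = inner x (S' y).
Proof.
have [f fP] := choice (riesz_bop S).
have lin : linear f.
  move=> a x y; apply: rdot_inj => z; rewrite /rdot; congr complex.Re.
  by rewrite -fP linearPr /= !fP linearPr.
have bnd : exists M : R, forall x, rnorm (f x) <= M * rnorm x.
  have [M M0 SM] := bop_gt0_bounded S; exists M => y.
  have [->|fy] := eqVneq (f y) 0; first by rewrite rnorm0 mulr_ge0 ?rnorm_ge0 ?ltW.
  rewrite -(ler_pM2r (_ : 0 < rnorm (f y))) ?rnorm_gt0// -expr2 -rdotxx.
  have -> : rdot (f y) (f y) = rdot (S (f y)) y by rewrite /rdot fP.
  by rewrite (le_trans (rdot_le _ _))// mulrAC ler_wpM2r ?rnorm_ge0.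
by exists (Bop lin bnd).
Qed.

Lemma adjP V W (S : bop V W) x y : inner (S x) y = inner x (adj S y).
Proof. exact: (xgetPex _ (adj_exists S)). Qed.

Lemma rdot_adj V W (S : bop V W) x y : rdot (S x) y = rdot x (adj S y).
Proof. by rewrite /rdot adjP. Qed.

Lemma rdot_adjl V W (S : bop V W) x y : rdot (adj S y) x = rdot y (S x).
Proof. by rewrite rdotC -rdot_adj rdotC. Qed.

Lemma adj_unique V W (S : bop V W) (S' : bop W V) :
  (forall x y, rdot (S x) y = rdot x (S' y)) -> adj S = S'.
Proof.
move=> h; apply/bopP => y; apply: rdot_inj => x.
by rewrite -rdot_adj h.
Qed.

Lemma adjK V W (S : bop V W) : adj (adj S) = S.
Proof. by apply: adj_unique => x y; rewrite rdot_adjl. Qed.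

Lemma adj_bound V W (S : bop V W) (M : R) : 0 <= M ->
  (forall x, rnorm (S x) <= M * rnorm x) ->
  forall y, rnorm (adj S y) <= M * rnorm y.
Proof.
move=> M0 SM y; apply: rnorm_le_dual; first by rewrite mulr_ge0 ?rnorm_ge0.
move=> x; rewrite rdot_adjl (le_trans (rdot_le _ _))// mulrC mulrAC.
by rewrite ler_wpM2r ?rnorm_ge0.
Qed.

Definition symmetric_bop V (S : bop V V) := forall x y, rdot (S x) y = rdot x (S y).

Lemma symmetric_inner V (S : bop V V) : symmetric_bop S ->
  forall x y, inner (S x) y = inner x (S y).
Proof.
move=> h x y; apply: inner_eq_rdot; first exact: h.
by rewrite -bopZ h.
Qed.

(** Polarisation: <Sx, x> is real for every x; expand at x + y, then replace x by i x. *)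
Lemma positive_symmetric V (S : bop V V) : positive_bop S -> symmetric_bop S.
Proof.
move=> Sp.
have im x : rdot ('i *: S x) x = 0.
  have := Sp x; rewrite innerE lecE /= => /andP[/eqP h _].
  by apply/eqP; rewrite -oppr_eq0 h.
have pol x y : rdot ('i *: S x) y + rdot ('i *: S y) x = 0.
  have := im (x + y); rewrite bopD scalerDr !(rdotDl, rdotDr) !im.
  by rewrite add0r addr0; move=> <-; rewrite addrC.
move=> x y; have := pol ('i *: x) y; rewrite bopZ rdotiZ scalerA.
rewrite -expr2 sqr_i scaleN1r rdotNl => /eqP; rewrite addrC subr_eq0 => /eqP h.
by rewrite -h rdotC.
Qed.

Lemma positive_bopP V (S : bop V V) : positive_bop S <->
  symmetric_bop S /\ (forall x, 0 <= rdot (S x) x).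
Proof.
split=> [Sp|[Ss Sp] x].
  split; first exact: positive_symmetric.
  by move=> x; have := Sp x; rewrite innerE lecE /= => /andP[].
rewrite innerE lecE /= Sp andbT; apply/eqP.
have := Ss x ('i *: x); rewrite bopZ (rdotC x) => h.
have h2 : rdot ('i *: S x) x = - rdot (S x) ('i *: x) by rewrite rdotiC.
by rewrite h in h2; lra.
Qed.

(** The lower bound makes S injective with closed range, the last hypothesis makes the range dense,
    and the inverse is then bounded by 1/d. *)
Lemma bounded_below_inverse V (S : bop V V) (d : R) : 0 < d ->
  (forall x, d * rnorm x <= rnorm (S x)) ->
  (forall z, (forall x, rdot (S x) z = 0) -> z = 0) ->
  exists Q : bop V V, S ∘ Q = bop_id V /\ Q ∘ S = bop_id V.
Proof.
move=> d0 Sd Sz.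
have inj x y : S x = S y -> x = y.
  move=> xy; apply/eqP; rewrite -subr_eq0 -rnorm_eq0 eq_le rnorm_ge0 andbT.
  have := Sd (x - y); rewrite bopB xy subrr rnorm0 => h.
  by rewrite -(pmulr_rle0 _ d0).
have [M M0 SM] := bop_gt0_bounded S.
have [K KP] : exists K : csubspace V, forall y, y \in K <-> exists x, S x = y.
  apply: csub_exists => [|a _ _ [x <-] [y <-]|l ld].
  - by exists 0; rewrite linear0.
  - by exists (a *: x + y); rewrite linearP.
  - have /choice[u uP] : forall n : nat, exists x, rnorm (S x - l) < n.+1%:R^-1.
      by move=> n; have [|_ [x <-] h] := ld n.+1%:R^-1; [rewrite invr_gt0|exists x].
    have uc : forall e : R, 0 < e -> exists N, forall m n, (N <= m)%N -> (N <= n)%N ->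
       rnorm (u m - u n) < e.
      move=> e e0; exists (Num.truncn (2 / (d * e))) => m n Nm Nn.
      have small j : (Num.truncn (2 / (d * e)) <= j)%N -> j.+1%:R^-1 < d * e / 2 :> R.
        move=> Nj; rewrite -[d * e / 2]invrK invf_div ltf_pV2 ?posrE ?divr_gt0 ?mulr_gt0//.
        by rewrite (lt_le_trans (truncnS_gt _))// ler_nat ltnS.
      have := Sd (u m - u n); rewrite bopB.
      have -> : S (u m) - S (u n) = (S (u m) - l) - (S (u n) - l).
        by rewrite opprB addrA subrK.
      move=> h; have := rnormD (S (u m) - l) (- (S (u n) - l)); rewrite rnormN => h2.
      have := uP m; have := uP n; have := small _ Nm; have := small _ Nn.
      move=> h3 h4 h5 h6; rewrite -(ltr_pM2l d0).
      apply: (le_lt_trans h); apply: (le_lt_trans h2).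
      by rewrite [ltRHS]splitr ltrD// (lt_trans h5, lt_trans h6).
    have [p pP] := cauchy_seq_limit uc; exists p.
    apply/eqP; rewrite -subr_eq0 -rnorm_eq0 eq_le rnorm_ge0 andbT.
    apply/ler_addgt0Pl => e e0; rewrite addr0.
    have e2 : 0 < e / 2 by rewrite divr_gt0.
    have [N pN] := pP _ (divr_gt0 e2 M0).
    pose n := maxn N (Num.truncn (2 / e)).
    have h1 : n.+1%:R^-1 < e / 2 :> R.
      rewrite -[e / 2]invrK invf_div ltf_pV2 ?posrE ?divr_gt0//.
      by rewrite (lt_le_trans (truncnS_gt _))// ler_nat ltnS leq_maxr.
    have h2 : rnorm (S (u n) - S p) <= e / 2.
      rewrite -bopB (le_trans (SM _))// mulrC -ler_pdivlMr// ltW//.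
      by apply: pN; exact: leq_maxl.
    rewrite -(subrKA (S (u n))) (le_trans (rnormD _ _))// rnormB.
    have := uP n => h3; rewrite (splitr e) lerD// ltW//; exact: lt_trans h3 h1.
have surj y : exists x, S x = y.
  have [p [pK pP]] := projection K y.
  have [z zp] := (KP p).1 pK; exists z; rewrite zp.
  have yp : y - p = 0 by apply: Sz => w; rewrite rdotC; apply: pP; apply/KP; exists w.
  by move/eqP: yp; rewrite subr_eq0 => /eqP ->.
have [f fP] := choice surj.
have lin : linear f by move=> a x y; apply: inj; rewrite fP bopD bopZ !fP.
have bnd : exists M : R, forall x, rnorm (f x) <= M * rnorm x.
  exists d^-1 => x; rewrite -(ler_pM2l d0) mulrA mulfV ?gt_eqF// mul1r.
  by rewrite (le_trans (Sd _))// fP.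
exists (Bop lin bnd); split; apply/bopP => x /=; first exact: fP.
by apply: inj; rewrite fP.
Qed.

End Adjoint.

(** * The positive square root *)

(** Paired with an arbitrary vector, an identity between vectors becomes a linear identity between
    reals. *)
Ltac vlin := apply: rdot_inj => ?;
  rewrite ?(rdotDr, rdotNr, rdotZr, rdot0r) ?(rdotDr, rdotNr, rdotZr, rdot0r);
  lra.

Section SquareRoot.
Variables (R : realType) (V : hilbertType R).

(* Scalar majorant of the iteration [Y_(n+1) = (A + Y_n^2) / 2]. *)
Fixpoint sqrt_maj (n : nat) : R :=
  if n is k.+1 then (1 + sqrt_maj k ^+ 2) / 2 else 0.

Lemma sqrt_maj_bounds n : 0 <= sqrt_maj n <= 1.
Proof.
elim: n => [|n /andP[h0 h1]] /=; first by rewrite lexx ler01.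
have h2 : sqrt_maj n ^+ 2 <= 1 by rewrite expr_le1.
have h3 := sqr_ge0 (sqrt_maj n).
by apply/andP; split; lra.
Qed.

Lemma sqrt_maj_le n : sqrt_maj n <= sqrt_maj n.+1.
Proof.
elim: n => [|n IH]; first by have /andP[] := sqrt_maj_bounds 1.
have /andP[h0 h1] := sqrt_maj_bounds n; have /andP[h2 h3] := sqrt_maj_bounds n.+1.
rewrite [leRHS]/= [leLHS]/= ler_wpM2r ?invr_ge0// lerD2l lerXn2r ?nnegrE//.
Qed.

(** Packages the convergence of [sqrt_maj] to its supremum so that [sqrt_fixpoint] can discard any
    error dominated by C (s - [sqrt_maj n]) for all n. *)
Lemma sqrt_maj_sup : exists2 s : R, s <= 1 & forall a C : R,
  (forall n, sqrt_maj n <= s) /\ (0 <= C -> (forall n, a <= C * (s - sqrt_maj n)) -> a <= 0).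
Proof.
pose A := range sqrt_maj.
have hs : has_sup A.
  split; first by exists (sqrt_maj 0); exists 0%N.
  by exists 1 => _ [n _ <-]; have /andP[] := sqrt_maj_bounds n.
exists (sup A).
  by apply: ge_sup; [case: hs|move=> _ [n _ <-]; have /andP[] := sqrt_maj_bounds n].
move=> a C; split=> [n|C0 h]; first by apply: ub_le_sup; [case: hs|exists n].
apply/ler_addgt0Pl => e e0; rewrite addr0.
have e1 : 0 < e / (C + 1) by rewrite divr_gt0// ltr_wpDl.
have [_ [n _ <-] hn] := sup_adherent e1 hs.
apply: (le_trans (h n)).
have hd : sup A - sqrt_maj n < e / (C + 1) by lra.
have hp : 0 <= sup A - sqrt_maj n by rewrite subr_ge0 ub_le_sup//; [case: hs|exists n].
apply: (@le_trans _ _ ((C + 1) * (sup A - sqrt_maj n))).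
  by rewrite ler_wpM2r// lerDl.
by rewrite mulrC -ler_pdivlMr ?ltW// ltr_wpDl.
Qed.

Variable A : bop V V.
Hypothesis A1 : forall x, rnorm (A x) <= rnorm x.
Hypothesis Asym : symmetric_bop A.

Fixpoint sqrt_iter (n : nat) : bop V V :=
  if n is k.+1 then (2^-1)%:C *: (A + sqrt_iter k ∘ sqrt_iter k) else 0.

Lemma sqrt_iterS n x :
  sqrt_iter n.+1 x = (2^-1)%:C *: (A x + sqrt_iter n (sqrt_iter n x)).
Proof. by []. Qed.

Lemma sqrt_iter_sym n : symmetric_bop (sqrt_iter n).
Proof.
elim: n => [|n IH] x y; first by rewrite /= rdot0l rdot0r.
by rewrite !sqrt_iterS rdotZl rdotZr rdotDl rdotDr Asym !IH.
Qed.

Lemma sqrt_iter_bound n x : rnorm (sqrt_iter n x) <= sqrt_maj n * rnorm x.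
Proof.
elim: n x => [|n IH] x; first by rewrite /= rnorm0 mul0r.
have /andP[h0 h1] := sqrt_maj_bounds n.
rewrite sqrt_iterS rnormZR ?invr_ge0//= mulrAC mulrC ler_wpM2r ?invr_ge0//.
rewrite (le_trans (rnormD _ _))// mulrDl mul1r lerD// (le_trans (IH _))//.
by rewrite expr2 -mulrA ler_wpM2l.
Qed.

Lemma sqrt_iter_step n x : rnorm (sqrt_iter n.+1 x - sqrt_iter n x)
  <= (sqrt_maj n.+1 - sqrt_maj n) * rnorm x.
Proof.
elim: n x => [|n IH] x.
  rewrite sqrt_iterS /= addr0 subr0 subr0 expr0n addr0 mul1r.
  by rewrite rnormZR ?invr_ge0// ler_wpM2l ?invr_ge0.
have /andP[h0 _] := sqrt_maj_bounds n; have /andP[h1 _] := sqrt_maj_bounds n.+1.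
have hd : 0 <= sqrt_maj n.+1 - sqrt_maj n by rewrite subr_ge0 sqrt_maj_le.
set Y := sqrt_iter n.+1 in IH *; set Z := sqrt_iter n in IH *.
(* Y^2 - Z^2 = Y (Y - Z) + (Y - Z) Z; the scalar majorant satisfies the same identity. *)
have -> : sqrt_iter n.+2 x - Y x =
    (2^-1)%:C *: (Y (Y x - Z x) + (Y (Z x) - Z (Z x))).
  have -> : sqrt_iter n.+2 x - Y x =
      (2^-1)%:C *: (A x + Y (Y x)) - (2^-1)%:C *: (A x + Z (Z x)) by [].
  by rewrite bopB; vlin.
rewrite rnormZR ?invr_ge0//.
have -> : (sqrt_maj n.+2 - sqrt_maj n.+1) * rnorm x =
   2^-1 * (sqrt_maj n.+1 * ((sqrt_maj n.+1 - sqrt_maj n) * rnorm x)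
     + (sqrt_maj n.+1 - sqrt_maj n) * (sqrt_maj n * rnorm x)).
  have -> : sqrt_maj n.+2 - sqrt_maj n.+1 =
    (1 + sqrt_maj n.+1 ^+ 2) / 2 - (1 + sqrt_maj n ^+ 2) / 2 by [].
  by ring.
rewrite ler_wpM2l ?invr_ge0// (le_trans (rnormD _ _))// lerD//.
  by rewrite (le_trans (sqrt_iter_bound _ _))// ler_wpM2l.
by rewrite (le_trans (IH _))// ler_wpM2l// sqrt_iter_bound.
Qed.

Lemma sqrt_iter_cauchy n k x : rnorm (sqrt_iter (k + n) x - sqrt_iter n x)
  <= (sqrt_maj (k + n) - sqrt_maj n) * rnorm x.
Proof.
elim: k => [|k IH]; first by rewrite !subrr rnorm0 mul0r.
rewrite -(subrKA (sqrt_iter (k + n) x)) -(subrKA (sqrt_maj (k + n)) (sqrt_maj _)).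
by rewrite (le_trans (rnormD _ _))// mulrDl lerD// sqrt_iter_step.
Qed.

(** The equation 2Y = A + Y^2 says (1 - Y)^2 = 1 - A, so 1 - Y is a square root. The increments
    telescope against [sqrt_maj], and the iterates converge pointwise with error at most (s -
    [sqrt_maj n]) |x|. *)
Lemma sqrt_fixpoint : exists Y : bop V V, [/\ symmetric_bop Y,
  forall x, rnorm (Y x) <= rnorm x & forall x, 2%:R%:C *: Y x = A x + Y (Y x)].
Proof.
have [s s1 sP] := sqrt_maj_sup.
have ms n : sqrt_maj n <= s by have [] := sP 0 0.
have small (a C : R) : 0 <= C -> (forall n, a <= C * (s - sqrt_maj n)) -> a <= 0.
  by have [] := sP a C.
have /choice[f fP] : forall x, exists l, forall n,
    rnorm (sqrt_iter n x - l) <= (s - sqrt_maj n) * rnorm x.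
  move=> x.
  have dist n k : (n <= k)%N -> rnorm (sqrt_iter k x - sqrt_iter n x)
      <= (s - sqrt_maj n) * rnorm x.
    move=> nk; rewrite -(subnK nk) (le_trans (sqrt_iter_cauchy _ _ _))//.
    by rewrite ler_wpM2r ?rnorm_ge0// lerD2r.
  have uc : forall e : R, 0 < e -> exists N, forall m n, (N <= m)%N -> (N <= n)%N ->
      rnorm (sqrt_iter m x - sqrt_iter n x) < e.
    move=> e e0; apply/not_existsP => h.
    have : e / 2 <= 0.
      apply: (small _ (rnorm x)); first exact: rnorm_ge0.
      move=> N; rewrite leNgt; apply/negP => hN; apply: (h N) => m n Nm Nn.
      rewrite -(subrKA (sqrt_iter N x)) (le_lt_trans (rnormD _ _))//.
      rewrite (rnormB (sqrt_iter N x)) [ltRHS]splitr ltrD//.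
        by rewrite (le_lt_trans (dist _ _ Nm))// mulrC.
      by rewrite (le_lt_trans (dist _ _ Nn))// mulrC.
    by rewrite leNgt divr_gt0.
  have [l lP] := cauchy_seq_limit uc; exists l => n.
  apply/ler_addgt0Pl => e e0; have [N hN] := lP e e0.
  pose k := maxn N n.
  rewrite -(subrKA (sqrt_iter k x)) addrC (le_trans (rnormD _ _))// lerD//.
    by rewrite ltW// hN// leq_maxl.
  by rewrite rnormB dist// leq_maxr.
have lin : linear f.
  move=> a x y; apply/eqP; rewrite -subr_eq0 -rnorm_eq0 eq_le rnorm_ge0 andbT.
  apply: (small _ (rnorm (a *: x + y) + (complex.Re `|a| * rnorm x + rnorm y))).
    by rewrite !addr_ge0 ?rnorm_ge0// -rnormZ rnorm_ge0.
  move=> n; rewrite -(subrKA (sqrt_iter n (a *: x + y))) mulrDl.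
  rewrite (le_trans (rnormD _ _))// lerD//; first by rewrite rnormB mulrC fP.
  rewrite linearP opprD addrACA -scalerBr (le_trans (rnormD _ _))// mulrDl lerD//.
    rewrite rnormZ -mulrA ler_wpM2l//; last by rewrite mulrC fP.
    by rewrite -ler0c RRe_real// ger0_real.
  by rewrite mulrC fP.
have bnd1 x : rnorm (f x) <= rnorm x.
  have h : rnorm (f x) <= s * rnorm x.
    have := fP x 0; rewrite /= sub0r rnormN subr0; exact.
  by rewrite (le_trans h)// ler_piMl ?rnorm_ge0.
have bnd : exists M : R, forall x, rnorm (f x) <= M * rnorm x.
  by exists 1 => x; rewrite mul1r.
exists (Bop lin bnd); split=> [x y|//|x] /=.
  apply/eqP; rewrite -subr_eq0 -normr_le0.
  apply: (small _ (2 * (rnorm x * rnorm y))).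
    by rewrite !mulr_ge0 ?rnorm_ge0.
  move=> n.
  have -> : rdot (f x) y - rdot x (f y) =
     rdot x (sqrt_iter n y - f y) - rdot (sqrt_iter n x - f x) y.
    by rewrite rdotBl rdotBr sqrt_iter_sym; lra.
  rewrite (le_trans (ler_normB _ _))//.
  have -> : 2 * (rnorm x * rnorm y) * (s - sqrt_maj n) =
    rnorm x * ((s - sqrt_maj n) * rnorm y) + (s - sqrt_maj n) * rnorm x * rnorm y by ring.
  rewrite lerD// (le_trans (ler_rdot _ _))//.
    by rewrite ler_wpM2l ?rnorm_ge0.
  by rewrite ler_wpM2r ?rnorm_ge0.
apply/eqP; rewrite -subr_eq0 -rnorm_eq0 eq_le rnorm_ge0 andbT.
apply: (small _ (4 * rnorm x)); first by rewrite mulr_ge0 ?rnorm_ge0.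
move=> n; have sn : 0 <= s - sqrt_maj n by rewrite subr_ge0.
have -> : 2%:R%:C *: f x - (A x + f (f x)) =
   2%:R%:C *: (f x - sqrt_iter n.+1 x) +
   (sqrt_iter n (sqrt_iter n x - f x) + (sqrt_iter n (f x) - f (f x))).
  by rewrite sqrt_iterS bopB; vlin.
have -> : 4 * rnorm x * (s - sqrt_maj n) = 2 * ((s - sqrt_maj n) * rnorm x) +
   (1 * ((s - sqrt_maj n) * rnorm x) + (s - sqrt_maj n) * rnorm x) by ring.
rewrite (le_trans (rnormD _ _))// lerD//.
  rewrite rnormZR// ler_wpM2l// rnormB (le_trans (fP _ _))//.
  by rewrite ler_wpM2r ?rnorm_ge0// lerD2l lerN2 sqrt_maj_le.
rewrite (le_trans (rnormD _ _))// lerD//.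
  rewrite (le_trans (sqrt_iter_bound _ _))// ler_pM ?rnorm_ge0//.
    by have /andP[] := sqrt_maj_bounds n.
  by have /andP[] := sqrt_maj_bounds n.
by rewrite (le_trans (fP _ _))// ler_wpM2l.
Qed.

End SquareRoot.

Section AbsoluteValue.
Variables (R : realType) (V : hilbertType R) (T : bop V V).

Lemma sqrt_bop_exists : exists Q : bop V V, positive_bop Q /\ Q ∘ Q = adj T ∘ T.
Proof.
have [M M0 TM] := bop_gt0_bounded T.
have TaM y : rnorm (adj T y) <= M * rnorm y by apply: adj_bound (ltW M0) TM y.
(* This scaling makes A = 1 - c P, for P = adj T T, a contraction: |Ax|^2 <= |x|^2 - c |Tx|^2. *)
have [c c0 cM] : exists2 c : R, 0 < c & c * M ^+ 2 = 1.
  by exists (M ^+ 2)^-1; rewrite ?invr_gt0 ?exprn_gt0// mulVf// gt_eqF// exprn_gt0.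
pose A : bop V V := bop_id V - c%:C *: (adj T ∘ T).
have AE x : A x = x - c%:C *: adj T (T x) by [].
have Asym : symmetric_bop A.
  by move=> x y; rewrite !AE rdotBl rdotBr rdotZl rdotZr rdot_adjl -rdot_adj.
have A1 x : rnorm (A x) <= rnorm x.
  rewrite -(@ler_pXn2r _ 2)// ?nnegrE ?rnorm_ge0// AE rnormB2.
  rewrite rdotZr -rdot_adj rdotxx (rnormZR _ (ltW c0)) exprMn.
  have h : rnorm (adj T (T x)) ^+ 2 <= M ^+ 2 * rnorm (T x) ^+ 2.
    by rewrite -exprMn lerXn2r ?nnegrE ?rnorm_ge0 ?TaM// mulr_ge0 ?rnorm_ge0 ?ltW.
  have h2 : c ^+ 2 * rnorm (adj T (T x)) ^+ 2 <= c * rnorm (T x) ^+ 2.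
    have := ler_wpM2l (ltW c0) h; rewrite (mulrA c (M ^+ 2)) cM mul1r => /(ler_wpM2l (ltW c0)).
    by rewrite (mulrA c c) -expr2.
  have h3 : 0 <= c * rnorm (T x) ^+ 2 by rewrite mulr_ge0 ?sqr_ge0 ?ltW.
  by lra.
have [Y [Ysym Y1 YE]] := sqrt_fixpoint A1 Asym.
(* (1 - Y)^2 = 1 - A = c P, and the factor M undoes the scaling since M^2 c = 1. *)
pose Q : bop V V := M%:C *: (bop_id V - Y).
have QE x : Q x = M%:C *: (x - Y x) by [].
exists Q; split.
  apply/positive_bopP; split=> [x y|x].
    by rewrite !QE rdotZl rdotZr rdotBl rdotBr Ysym.
  rewrite QE rdotZl mulr_ge0 ?(ltW M0)// rdotBl rdotxx subr_ge0.
  by rewrite (le_trans (rdot_le _ _))// expr2 ler_wpM2r ?rnorm_ge0.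
apply/bopP => x; have -> : (Q ∘ Q) x = Q (Q x) by [].
have -> : (adj T ∘ T) x = adj T (T x) by [].
rewrite 2!QE bopZ bopB -scalerBr scalerA.
have -> : x - Y x - (Y x - Y (Y x)) = c%:C *: adj T (T x).
  have := YE x; rewrite AE => h.
  have -> : x - Y x - (Y x - Y (Y x)) = x + Y (Y x) - 2%:R%:C *: Y x.
    by vlin.
  by rewrite h; vlin.
by rewrite scalerA -!rmorphM -expr2 mulrC cM scale1r.
Qed.

Lemma abs_bop_spec : positive_bop (abs_bop T) /\ abs_bop T ∘ abs_bop T = adj T ∘ T.
Proof. exact: (xgetPex _ sqrt_bop_exists). Qed.

End AbsoluteValue.

(** * Finite families and compactness *)

Section FiniteFamilies.
Variables (R : realType) (V : hilbertType R).
Implicit Types (x y : V) (E F G : seq V) (K L : csubspace V).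

Lemma innerBl x y z : inner (x - y) z = inner x z - inner y z.
Proof. by rewrite linearBl. Qed.

Lemma innerDl x y z : inner (x + y) z = inner x z + inner y z.
Proof. by rewrite linearDl. Qed.

Lemma innerZl (a : R[i]) x z : inner (a *: x) z = a * inner x z.
Proof. by rewrite linearZl_LR. Qed.

Lemma inner_suml (I : Type) (r : seq I) (P : pred I) (f : I -> V) z :
  inner (\sum_(i <- r | P i) f i) z = \sum_(i <- r | P i) inner (f i) z.
Proof.
elim/big_rec2: _ => [|i y1 y2 _ <-]; first by rewrite linear0l.
by rewrite innerDl.
Qed.

(** For finite lists F these sets stand for the subspaces of finite codimension; concatenating lists
    intersects them. *)
Definition perp F x := forall y, y \in F -> inner x y = 0.

Lemma perp_cat F G x : perp (F ++ G) x <-> perp F x /\ perp G x.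
Proof.
split=> [h|[hF hG] y]; last by rewrite mem_cat => /orP[/hF|/hG].
by split=> y yF; apply: h; rewrite mem_cat yF ?orbT.
Qed.

Lemma perpD F x y : perp F x -> perp F y -> perp F (x + y).
Proof. by move=> hx hy z zF; rewrite innerDl hx// hy// addr0. Qed.

Lemma perpZ F a x : perp F x -> perp F (a *: x).
Proof. by move=> hx z zF; rewrite innerZl hx// mulr0. Qed.

(** There are more unknown coefficients than linear equations: the matrix of inner products has rank
    at most [size G], hence a nonzero left kernel. *)
Lemma perp_combination n (v : 'I_n -> V) G : (size G < n)%N ->
  exists2 c : 'I_n -> R[i], exists i, c i != 0 & perp G (\sum_i c i *: v i).
Proof.
move=> Gn.
pose M : 'M[R[i]]_(n, size G) := \matrix_(i, j) inner (v i) (nth 0 G j).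
have : kermx M != 0.
  rewrite kermx_eq0 /row_free; apply: contraTneq Gn => <-.
  by rewrite -leqNgt rank_leq_col.
move=> /rowV0Pn[c /sub_kermxP cM c0]; exists (fun i => c 0 i).
  apply: contrapT => /forallNP h; move/eqP: c0; apply; apply/rowP => i.
  by rewrite mxE; have /negP := h i; rewrite negbK => /eqP.
move=> y yG; rewrite inner_suml.
have jG : (index y G < size G)%N by rewrite index_mem.
have /(congr1 (fun A : 'rV_(size G) => A 0 (Ordinal jG))) := cM.
rewrite !mxE => h; rewrite -[RHS]h; apply: eq_bigr => i _.
by rewrite innerZl mxE /= nth_index.
Qed.

Lemma inner_sum_orthogonal n (v : 'I_n -> V) (c : 'I_n -> R[i]) j :
  (forall i k, i != k -> inner (v i) (v k) = 0) ->
  inner (\sum_i c i *: v i) (v j) = c j * inner (v j) (v j).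
Proof.
move=> vo; rewrite inner_suml (bigD1 j)//= innerZl big1 ?addr0// => i ij.
by rewrite innerZl vo// mulr0.
Qed.

Lemma inner_xx_eq0 x : (inner x x == 0) = (x == 0).
Proof.
by rewrite inner_xx -[0]/(0%:C) (inj_eq (@complexI R)) expf_eq0 /= rnorm_eq0.
Qed.

(** A longer family would have a nontrivial combination orthogonal to G, which is then 0, against
    orthogonality. Trivial intersection with [perp G] is the form in which finite dimension is
    carried through the proof. *)
Lemma orthogonal_family_bound (P : V -> Prop) G n (v : 'I_n -> V) :
  (forall c : 'I_n -> R[i], P (\sum_i c i *: v i)) ->
  (forall x, P x -> perp G x -> x = 0) ->
  (forall i, v i != 0) -> (forall i j, i != j -> inner (v i) (v j) = 0) ->
  (n <= size G)%N.
Proof.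
move=> vP PG v0 vo; rewrite leqNgt; apply/negP => /(perp_combination v)[c [j cj] cG].
have := PG _ (vP c) cG => c0; move: cj; apply/negP; rewrite negbK.
have := inner_sum_orthogonal c j vo; rewrite c0 linear0l => /esym/eqP.
by rewrite mulf_eq0 inner_xx_eq0 (negbTE (v0 j)) orbF.
Qed.

Definition orthonormal_seq E :=
  (forall e, e \in E -> inner e e = 1) /\ pairwise (fun x y => inner x y == 0) E.

Lemma orthonormal_seq_cons e E : orthonormal_seq (e :: E) <->
  [/\ inner e e = 1, forall f, f \in E -> inner e f = 0 & orthonormal_seq E].
Proof.
rewrite /orthonormal_seq pairwise_cons; split=> [[h1 /andP[/allP h2 h3]]|[h1 h2 [h3 h4]]].
  split; first by apply: h1; rewrite mem_head.
    by move=> f /h2/eqP.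
  by split=> // f fE; apply: h1; rewrite in_cons fE orbT.
split; first by move=> f; rewrite in_cons => /orP[/eqP ->//|/h3].
by rewrite h4 andbT; apply/allP => f /h2 ->.
Qed.

Definition fproj E x := \sum_(e <- E) inner x e *: e.

Lemma fproj_perp E x : orthonormal_seq E -> perp E (x - fproj E x).
Proof.
elim: E x => [|e E IH] x //= /orthonormal_seq_cons[ee eE Eon] f.
have sE y : perp E y -> inner (fproj E x) y = 0.
  move=> yE; rewrite /fproj big_seq_cond; rewrite inner_suml big1// => g /andP[gE _].
  by rewrite innerZl (inner0C (yE g gE)) mulr0.
rewrite in_cons /fproj big_cons opprD addrCA -/(fproj E x) => /orP[/eqP ->|fE].
  by rewrite innerDl linearNl /= innerZl ee mulr1 innerBl sE// subr0 addNr.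
by rewrite innerDl linearNl /= innerZl eE// mulr0 oppr0 add0r IH.
Qed.

Lemma normalize x : x != 0 -> inner ((rnorm x)^-1%:C *: x) ((rnorm x)^-1%:C *: x) = 1.
Proof. by move=> x0; rewrite inner_xx unit_scale// expr1n. Qed.

Lemma gram_schmidt F :
  exists2 E, orthonormal_seq E & forall x, perp E x -> perp F x.
Proof.
elim: F => [|f F [E Eon EF]]; first by exists [::].
pose r := f - fproj E f.
have [r0|r0] := eqVneq r 0.
  exists E => // x xE y; rewrite in_cons => /orP[/eqP ->|]; last exact: EF.
  have -> : f = fproj E f by apply/eqP; rewrite -subr_eq0 -/r r0.
  apply: inner0C; rewrite /fproj big_seq_cond inner_suml big1// => g /andP[gE _].
  by rewrite innerZl (inner0C (xE g gE)) mulr0.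
exists ((rnorm r)^-1%:C *: r :: E).
  apply/orthonormal_seq_cons; split=> //; first exact: normalize.
  by move=> e eE; rewrite innerZl (fproj_perp f Eon) ?mulr0.
move=> x xE.
have xE' : perp E x by move=> e eE; apply: xE; rewrite in_cons eE orbT.
move=> y; rewrite in_cons => /orP[/eqP ->|]; last exact: EF.
rewrite -(subrK (fproj E f) f) -/r; apply: inner0C; rewrite innerDl.
have -> : inner r x = 0.
  apply: inner0C.
  have := xE _ (mem_head _ _); move/inner0C; rewrite innerZl => /eqP.
  rewrite mulf_eq0 => /orP[|/eqP/inner0C//].
  by rewrite -[0]/(0%:C) (inj_eq (@complexI R)) invr_eq0 rnorm_eq0 (negbTE r0).
rewrite add0r /fproj big_seq_cond inner_suml big1// => g /andP[gE _].
by rewrite innerZl (inner0C (xE' g gE)) mulr0.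
Qed.

Lemma orthonormal_seq_bound (P : V -> Prop) G E : orthonormal_seq E ->
  (forall c : nat -> R[i], P (\sum_(i < size E) c i *: nth 0 E i)) ->
  (forall x, P x -> perp G x -> x = 0) -> (size E <= size G)%N.
Proof.
move=> [E1 E2] EP PG.
have key i j : (i < size E)%N -> (j < size E)%N -> (i < j)%N ->
    inner (nth 0 E i) (nth 0 E j) = 0.
  by move=> iE jE ij; apply/eqP; move/(pairwiseP 0): E2; apply; rewrite ?inE.
apply: (@orthogonal_family_bound P G (size E) (fun i => nth 0 E i)) => //.
- move=> c; have := EP (fun k => if insub k is Some i then c i else 0).
  by congr (P _); apply: eq_bigr => i _; rewrite valK.
- move=> i; apply/eqP => h; have := E1 _ (mem_nth 0 (ltn_ord i)).
  by rewrite h linear0l => /eqP; rewrite eq_sym oner_eq0.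
- move=> i j; rewrite -val_eqE neq_ltn => /orP[ij|ji]; first exact: key.
  exact/inner0C/key.
Qed.

(** An orthonormal list in K can be extended as long as it does not span K, and
    [orthonormal_seq_bound] caps its length by [size G]. *)
Lemma finite_dimensional_of_perp0 K G :
  (forall x, x \in K -> perp G x -> x = 0) -> finite_dimensional [set` K].
Proof.
move=> KG.
have step n : (exists E, [/\ orthonormal_seq E, forall e, e \in E -> e \in K &
     forall x, x \in K -> x = fproj E x]) \/
   (exists E, [/\ orthonormal_seq E, forall e, e \in E -> e \in K & size E = n]).
  elim: n => [|n [|[E [Eon EK En]]]]; [by right; exists [::]|by left|].
  have [h|/existsNP[x /not_implyP[xK xE]]] :=
    pselect (forall x, x \in K -> x = fproj E x); first by left; exists E.
  right; pose r := x - fproj E x.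
  have r0 : r != 0 by rewrite subr_eq0; apply/eqP.
  exists ((rnorm r)^-1%:C *: r :: E); split=> /=; last by rewrite En.
    apply/orthonormal_seq_cons; split=> //; first exact: normalize.
    by move=> e eE; rewrite innerZl (fproj_perp x Eon) ?mulr0.
  move=> e; rewrite in_cons => /orP[/eqP ->|/EK//].
  rewrite rpredZ// rpredB// /fproj big_seq_cond rpred_sum// => f /andP[fE _].
  by rewrite rpredZ// EK.
have [[E [Eon EK Ex]]|[E [Eon EK En]]] := step (size G).+1; last first.
  suff : ((size G).+1 <= size G)%N by rewrite ltnn.
  rewrite -En; apply: (orthonormal_seq_bound (P := fun x => x \in K) Eon _ KG) => c.
  rewrite rpred_sum// => i _.
  by rewrite rpredZ// EK// mem_nth.
exists (size E), (fun i => nth 0 E i); apply/seteqP; split=> x /=.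
  move=> xK; exists (fun i => inner x (nth 0 E i)) => //.
  by rewrite [RHS](Ex x xK) /fproj (big_nth 0) big_mkord.
move=> [c _ <-]; rewrite rpred_sum// => i _.
by rewrite rpredZ// EK// mem_nth.
Qed.

Lemma perp_unit F : ~ finite_dimensional [set: V] ->
  exists2 x, rnorm x = 1 & perp F x.
Proof.
move=> infV.
have [K KP] : exists K : csubspace V, forall x, x \in K <-> True.
  by apply: csub_exists.
have [h|/existsNP[x /not_implyP[xF /eqP x0]]] :=
    pselect (forall x, perp F x -> x = 0).
  exfalso; apply: infV.
  have -> : [set: V] = [set` K] by apply/seteqP; split=> x // _; exact/KP.
  by apply: (@finite_dimensional_of_perp0 K F) => x _; exact: h.
by exists ((rnorm x)^-1%:C *: x); [exact: unit_scale|exact: perpZ].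
Qed.

End FiniteFamilies.

(** Choice with access to all earlier terms, for building orthogonal sequences and sequences of
    distinct eigenvalues. *)
Lemma strong_choice (A : Type) (P : seq A -> A -> Prop) :
  (forall s, exists x, P s x) -> exists u : nat -> A, forall n, P (mkseq u n) (u n).
Proof.
move=> /choice[f fP].
pose s n := iter n (fun t => rcons t (f t)) [::].
exists (fun n => f (s n)) => n.
suff -> : mkseq (fun n => f (s n)) n = s n by exact: fP.
by elim: n => [//|n IH]; rewrite mkseqS IH.
Qed.

(** * Compact operators and smallness on subspaces of finite codimension *)

Section Compactness.
Variables (R : realType) (V : hilbertType R).
Implicit Types (x y : V) (E F : seq V) (K : bop V V).

(** Compactness of [-c, c] gives the image ultrafilter a cluster point a, and maximality of U
    upgrades clustering at a to closeness on a member of U. This stands in for extracting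
    subsequences. *)
Lemma ultra_oscillation (T : Type) (U : set_system T) (g : T -> R) (c d : R) :
  UltraFilter U -> U [set t | `|g t| <= c] -> 0 < d ->
  exists2 W, U W & forall s t, W s -> W t -> `|g s - g t| < d.
Proof.
move=> UU Uc d0.
have gU : (g @ U) `[- c, c]%classic.
  by rewrite /fmap/=; apply: filterS Uc => t /=; rewrite ler_norml in_itv.
have [a [_ ga]] := @segment_compact R (- c) c (g @ U) _ gU.
have d2 : 0 < d / 2 by rewrite divr_gt0.
have Ua : U [set t | `|a - g t| < d / 2].
  have [//|Uac] := in_ultra_setVsetC [set t | `|a - g t| < d / 2] UU.
  have : (g @ U) (g @` ~` [set t | `|a - g t| < d / 2]).
    by rewrite /fmap/=; apply: filterS Uac => t ht; exists t.
  move=> /ga/(_ (nbhsx_ballx a _ d2))[_ [[t nt <-]]].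
  by rewrite -ball_normE.
exists [set t | `|a - g t| < d / 2] => //.
move=> s t /= hs ht; rewrite -(subrKA a) (le_lt_trans (ler_normD _ _))//.
by rewrite [ltRHS]splitr ltrD// distrC.
Qed.

Lemma ultra_oscillation_seq (U : set_system V) (s : V -> V) (d : R) E :
  UltraFilter U -> U [set y | rnorm (s y) <= 1] -> 0 < d ->
  exists2 W, U W & forall x y, W x -> W y ->
    forall e, e \in E -> `|rdot (s x - s y) e| < d.
Proof.
move=> UU U1 d0; elim: E => [|e E [W UW WP]]; first by exists setT => //; exact: filterT.
have [|W' UW' WP'] := @ultra_oscillation _ U (fun y => rdot (s y) e) (rnorm e) d UU _ d0.
  apply: filterS U1 => y /= y1; rewrite (le_trans (ler_rdot _ _))//.
  by rewrite ler_piMl ?rnorm_ge0.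
exists (W `&` W'); first exact: filterI.
move=> x y [Wx W'x] [Wy W'y] f; rewrite in_cons => /orP[/eqP ->|fE]; last exact: WP.
by rewrite rdotBl; exact: WP'.
Qed.

(** The factor 2 counts the real and the imaginary part of each coefficient. *)
Lemma rnorm_fproj E x (d : R) : (forall e, e \in E -> inner e e = 1) ->
  (forall e, e \in E -> `|rdot x e| <= d) ->
  (forall e, e \in E -> `|rdot x ('i *: e)| <= d) ->
  rnorm (fproj E x) <= (size E)%:R * (2 * d).
Proof.
elim: E => [|e E IH] E1 h1 h2; first by rewrite /fproj big_nil rnorm0 mul0r.
rewrite /fproj big_cons /= -natr1 mulrDl mul1r addrC (le_trans (rnormD _ _))// lerD//.
  by apply: IH => f fE; [apply: E1|apply: h1|apply: h2]; rewrite in_cons fE orbT.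
have e1 : rnorm e = 1.
  have := E1 _ (mem_head _ _); rewrite inner_xx -[1]/(1%:C) => /complexI /eqP.
  by rewrite sqrf_eq1 => /orP[/eqP //|/eqP h]; have := rnorm_ge0 e; rewrite h; lra.
rewrite innerE rdotiC opprK.
have -> : rdot x e +i* rdot x ('i *: e) *: e =
   (rdot x e)%:C *: e + (rdot x ('i *: e))%:C *: ('i *: e).
  by rewrite scalerA -scalerDl; congr (_ *: _); rewrite [LHS]complexE /= mulrC.
rewrite (le_trans (rnormD _ _))// !rnormZ e1 mulr1.
rewrite !normc_def /= !expr0n !addr0 !sqrtr_sqr mulr_natl mulr2n lerD//.
  by apply: h1; rewrite mem_head.
by rewrite add0r expr1n sqrtr1 !mulr1; apply: h2; rewrite mem_head.
Qed.

(** Along an ultrafilter finitely many coordinates become almost constant, and K is small in the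
    remaining directions; so the ultrafilter is Cauchy on the image of the ball. *)
Lemma compact_of_small K :
  (forall e : R, 0 < e -> exists F, forall x, perp F x -> rnorm (K x) <= e * rnorm x) ->
  compact_bop K.
Proof.
move=> Ksmall; rewrite /compact_bop precompactE compact_ultra => U UU Ucl.
set A := K @` _ in Ucl *.
have Uc : cauchy U.
  apply/cauchy_exP => _ /gt0_complex[e5 e50 ->].
  (* The final estimate uses less than 5e: 3e for K z and e for each of the approximations K (s y)
     and K (s y0). *)
  have [e e0 ->] : exists2 e, 0 < e & e5 = 6 * e.
    by exists (e5 / 6); [rewrite divr_gt0|rewrite mulrC divfK].
  have /choice[s sP] : forall y, exists x, closure A y ->
      rnorm x <= 1 /\ rnorm (K x - y) < e.
    move=> y; have [yA|yA] := pselect (closure A y); last by exists 0.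
    have : nbhs y (ball y e%:C) by apply: nbhsx_ballx; rewrite ltcR.
    move=> /yA[_ [[x /= x1 <-]]]; rewrite -ball_normE /= rnormE ltcR => h.
    by exists x => _; split=> //; rewrite rnormB.
  have [F0 FK] := Ksmall e e0.
  have [E Eon EF] := gram_schmidt F0.
  have [M M0 KM] := bop_gt0_bounded K.
  (* Chosen so that (M + e) |fproj E z| <= e; the + 1 keeps the denominator positive when E is
     empty. *)
  pose d := e / ((size E)%:R * 2 * (M + e) + 1).
  have D0 : 0 < (size E)%:R * 2 * (M + e) + 1.
    by rewrite ltr_wpDl// !mulr_ge0// addr_ge0// ltW.
  have d0 : 0 < d by rewrite divr_gt0.
  have Us : U [set y | rnorm (s y) <= 1] by apply: filterS Ucl => y /sP[].
  (* The copies of E multiplied by i control the imaginary parts, which [rdot] does not see. *)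
  have [W UW WP] := ultra_oscillation_seq (E ++ map (fun e => 'i *: e) E) UU Us d0.
  have UWc : U (W `&` closure A) by exact: filterI.
  have [y0 [Wy0 Ay0]] := filter_ex UWc.
  exists y0; apply: filterS UWc => y [Wy Ay].
  rewrite -ball_normE /= rnormE ltcR.
  have [s01 Ks0] := sP _ Ay0; have [s1 Ks] := sP _ Ay.
  pose z := s y0 - s y.
  have z2 : rnorm z <= 2.
    by rewrite (le_trans (rnormD _ _))// rnormN; lra.
  have pz : rnorm (fproj E z) <= (size E)%:R * (2 * d).
    apply: rnorm_fproj; first by case: Eon.
      by move=> f fE; apply/ltW/WP => //; rewrite mem_cat fE.
    move=> f fE; apply/ltW/WP => //; rewrite mem_cat; apply/orP; right.
    exact: map_f.
  have Kz : rnorm (K z) <= 3 * e.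
    rewrite -[z](subrK (fproj E z)) bopD (le_trans (rnormD _ _))//.
    have h1 := FK _ (EF _ (fproj_perp z Eon)).
    have h2 := KM (fproj E z).
    have h3 := rnormD z (- fproj E z); rewrite rnormN in h3.
    have h4 : (M + e) * rnorm (fproj E z) <= e.
      apply: (@le_trans _ _ ((M + e) * ((size E)%:R * (2 * d)))).
        by rewrite ler_wpM2l// addr_ge0// ltW.
      rewrite (_ : _ * _ = ((size E)%:R * 2 * (M + e)) * d); last by ring.
      by rewrite /d mulrA ler_pdivrMr// mulrC ler_wpM2l ?ltW// ltrDl.
    have h5 : e * rnorm (z - fproj E z) <= e * (rnorm z + rnorm (fproj E z)).
      by rewrite ler_wpM2l// ltW.
    have h6 : e * rnorm z <= e * 2 by rewrite ler_wpM2l// ltW.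
    lra.
  have -> : y0 - y = (K (s y) - y) - (K (s y0) - y0) + K z by rewrite bopB; vlin.
  rewrite (le_lt_trans (rnormD _ _))//.
  have := rnormD (K (s y) - y) (- (K (s y0) - y0)); rewrite rnormN; lra.
move: Uc => /cauchy_cvg/cvg_ex[l Ul].
exists l; split=> //.
apply: (@closed_closure _ A) => B /Ul UB.
by have /filter_ex : U (closure A `&` B) by exact: filterI.
Qed.

(** An infinite orthonormal sequence in [perp F] has images at mutual distance at least d, so they
    cannot accumulate. *)
Lemma compact_not_bounded_below K F (d : R) : ~ finite_dimensional [set: V] ->
  0 < d -> (forall x, perp F x -> d * rnorm x <= rnorm (K x)) -> ~ compact_bop K.
Proof.
move=> infV d0 KF; rewrite /compact_bop precompactE => Kc.
have [u uP] : exists u : nat -> V, forall n,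
    rnorm (u n) = 1 /\ perp (F ++ mkseq u n) (u n).
  apply: (@strong_choice _ (fun s x => rnorm x = 1 /\ perp (F ++ s) x)) => s.
  by have [x x1 xF] := perp_unit (F ++ s) infV; exists x.
have uo m n : (m < n)%N -> d <= rnorm (K (u m) - K (u n)).
  move=> mn; rewrite -bopB.
  have [um1 /perp_cat[uF _]] := uP m; have [un1 /perp_cat[unF uo]] := uP n.
  have h : perp F (u m - u n) by apply: perpD => //; rewrite -scaleN1r; exact: perpZ.
  apply: le_trans (KF _ h); rewrite ler_peMr ?(ltW d0)//.
  rewrite -(@ler_pXn2r _ 2)// ?nnegrE ?rnorm_ge0// rnormB2 um1 un1 rdotC.
  rewrite inner0_rdot; first lra.
  by apply: uo; apply/mapP; exists m => //; rewrite mem_iota.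
set A := K @` _ in Kc.
pose W := (K \o u) @ \oo.
have WA : W (closure A).
  exists 0%N => // n _ /=; apply: subset_closure; exists (u n) => //=.
  by have [-> _] := uP n.
have [p [_ pcl]] := Kc W _ WA.
have d2 : 0 < d / 2 by rewrite divr_gt0.
have near N : exists2 n, (N <= n)%N & rnorm (K (u n) - p) < d / 2.
  have WN : W [set K (u n) | n in [set n | (N <= n)%N]].
    by exists N => // n /= Nn; exists n.
  have : nbhs p (ball p (d / 2)%:C) by apply: nbhsx_ballx; rewrite ltcR.
  move=> /(pcl _ _ WN)[_ [[n Nn <-]]]; rewrite -ball_normE /= rnormE ltcR => h.
  by exists n => //; rewrite rnormB.
have [m _ hm] := near 0%N; have [n mn hn] := near m.+1.
have := uo _ _ mn; rewrite leNgt => /negP; apply.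
rewrite -(subrKA p) (le_lt_trans (rnormD _ _))// (rnormB p).
by rewrite [ltRHS]splitr ltrD.
Qed.

End Compactness.

(** * Spectral structure of an absolutely minimum attaining operator *)

Section AbsolutelyMinimumAttaining.
Variables (R : realType) (V : hilbertType R) (T : bop V V).
Implicit Types (x y : V) (F G : seq V) (L : csubspace V).

Local Notation P := (adj T ∘ T).

Lemma rdot_gram x y : rdot (P x) y = rdot (T x) (T y).
Proof. exact: rdot_adjl. Qed.

Lemma gram_sym : symmetric_bop P.
Proof. by move=> x y; rewrite rdot_gram rdotC -rdot_gram rdotC. Qed.

Lemma rdot_gram_xx x : rdot (P x) x = rnorm (T x) ^+ 2.
Proof. by rewrite rdot_gram rdotxx. Qed.

Lemma gram_shiftE (c : R) x : (P - c%:C *: bop_id V) x = P x - c%:C *: x.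
Proof. by []. Qed.

Lemma gram_shift_sym (c : R) : symmetric_bop (P - c%:C *: bop_id V).
Proof.
by move=> x y; rewrite !gram_shiftE rdotBl rdotBr rdotZl rdotZr gram_sym.
Qed.

Lemma rdot_gram_shift (c : R) x :
  rdot ((P - c%:C *: bop_id V) x) x = rnorm (T x) ^+ 2 - c * rnorm x ^+ 2.
Proof. by rewrite gram_shiftE rdotBl rdotZl rdot_gram_xx rdotxx. Qed.

(** Cauchy-Schwarz for a semidefinite form: the quadratic in t obtained at x + t y is nonnegative
    and has no constant term, so its linear term vanishes. *)
Lemma form_null (W : bop V V) L x : symmetric_bop W ->
  (forall y, y \in L -> 0 <= rdot (W y) y) -> x \in L -> rdot (W x) x = 0 ->
  forall y, y \in L -> rdot (W x) y = 0.
Proof.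
move=> Ws Wp xL x0 y yL; apply: (@quad_ge0_lin0 _ _ (rdot (W y) y)) => t.
have := Wp (x + t%:C *: y); rewrite rpredD// ?rpredZ// => /(_ isT).
rewrite bopD bopZ !(rdotDl, rdotDr, rdotZl, rdotZr) x0 (Ws y x) (rdotC y).
by congr (_ <= _); ring.
Qed.

Hypothesis Tam : absolutely_min_attaining T.

Lemma am_min L x : x \in L -> x != 0 -> exists z, [/\ z \in L, rnorm z = 1 &
  forall y, y \in L -> rnorm (T z) * rnorm y <= rnorm (T y)].
Proof.
move=> xL x0; have [|z [zL z1 zm]] := Tam (L := L); first by exists x.
exists z; split=> // y yL; have [->|y0] := eqVneq y 0.
  by rewrite rnorm0 mulr0 rnorm_ge0.
have ny : 0 < rnorm y by rewrite rnorm_gt0.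
have : rnorm (T z) <= rnorm (T ((rnorm y)^-1%:C *: y)).
  rewrite zm /min_modulus; apply: ge_inf.
    by exists 0 => _ [w _ <-]; exact: rnorm_ge0.
  by exists ((rnorm y)^-1%:C *: y) => //; split; [rewrite rpredZ|exact: unit_scale].
by rewrite bopZ rnormZR ?invr_ge0 ?rnorm_ge0// mulrC ler_pdivlMr.
Qed.

(** For a minimiser z and b = |Tz|^2, the form of P - b is nonnegative on L and null at z.
    Invariance puts (P - b) z in L, so [form_null] makes it orthogonal to itself. *)
Lemma am_eigenvector L x : (forall y, y \in L -> P y \in L) -> x \in L -> x != 0 ->
  exists z (b : R), [/\ z \in L, rnorm z = 1, 0 <= b, P z = b%:C *: z &
    forall y, y \in L -> b * rnorm y ^+ 2 <= rnorm (T y) ^+ 2].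
Proof.
move=> LP xL x0; have [z [zL z1 zm]] := am_min xL x0.
have zm2 y : y \in L -> rnorm (T z) ^+ 2 * rnorm y ^+ 2 <= rnorm (T y) ^+ 2.
  move=> yL; rewrite -exprMn lerXn2r ?nnegrE ?mulr_ge0 ?rnorm_ge0//; exact: zm.
exists z, (rnorm (T z) ^+ 2); split=> //; first exact: sqr_ge0.
have : rdot ((P - (rnorm (T z) ^+ 2)%:C *: bop_id V) z) z = 0.
  by rewrite rdot_gram_shift z1 expr1n mulr1 subrr.
move=> /(form_null (gram_shift_sym _) _ zL) h.
apply/eqP; rewrite -subr_eq0; apply/eqP; rewrite -gram_shiftE.
set w := (X in X = 0).
have wL : w \in L by rewrite /w gram_shiftE rpredB// ?rpredZ// LP.
have : rdot w w = 0.
  by apply: h => // y yL; rewrite rdot_gram_shift subr_ge0 zm2.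
by rewrite rdotxx => /eqP; rewrite expf_eq0 /= rnorm_eq0 => /eqP.
Qed.

Hypothesis infV : ~ finite_dimensional [set: V].

Definition lower_ess (m : R) := forall e : R, 0 < e ->
  exists F, forall x, perp F x -> (m - e) * rnorm x ^+ 2 <= rnorm (T x) ^+ 2.

(** Unlike [lower_ess], this has no slack e; the exact bound is what makes the part above m finite
    dimensional in [top_subspace]. *)
Definition upper_ess (m : R) :=
  exists F, forall x, perp F x -> rnorm (T x) ^+ 2 <= m * rnorm x ^+ 2.

Lemma lower_ess_sup : exists m : R, [/\ 0 <= m, lower_ess m &
  forall (e : R) F, 0 < e ->
    exists2 x, perp F x & rnorm (T x) ^+ 2 < (m + e) * rnorm x ^+ 2].
Proof.
pose C := [set c : R | exists F, forall x, perp F x ->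
  c * rnorm x ^+ 2 <= rnorm (T x) ^+ 2].
have C0 : C 0 by exists [::] => x _; rewrite mul0r sqr_ge0.
have [M M0 TM] := bop_gt0_bounded T.
have hC : has_sup C.
  split; first by exists 0.
  exists (M ^+ 2) => c [F h]; have [x x1 /h] := perp_unit F infV.
  rewrite x1 expr1n mulr1 => /le_trans; apply.
  by rewrite lerXn2r ?nnegrE ?rnorm_ge0 ?(ltW M0)// (le_trans (TM x))// x1 mulr1.
exists (sup C); split.
- by apply: ub_le_sup => //; case: hC.
- move=> e e0; have [c [F h] hc] := sup_adherent e0 hC.
  exists F => x /h; apply: le_trans; rewrite ler_wpM2r ?sqr_ge0// ltW//.
- move=> e F e0; apply: contrapT => h.
  have : C (sup C + e).
    exists F => x xF; rewrite leNgt; apply/negP => hx; apply: h.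
    by exists x.
  move=> /(ub_le_sup (proj2 hC)); lra.
Qed.

(** If u itself does not qualify, its ratio |Tu|^2 / |u|^2 is at most m while that of v exceeds m,
    and an intermediate ratio m + d is reached at some u + t v. *)
Lemma value_between G (m e : R) u v : 0 < e ->
  perp G u -> rnorm (T u) ^+ 2 < (m + e) * rnorm u ^+ 2 ->
  perp G v -> m * rnorm v ^+ 2 < rnorm (T v) ^+ 2 ->
  exists2 z, rnorm z = 1 /\ perp G z & m < rnorm (T z) ^+ 2 < m + e.
Proof.
move=> e0 uG hu vG hv.
have nz w : perp G w -> m * rnorm w ^+ 2 < rnorm (T w) ^+ 2 < (m + e) * rnorm w ^+ 2 ->
    exists2 z, rnorm z = 1 /\ perp G z & m < rnorm (T z) ^+ 2 < m + e.
  move=> wG /andP[h1 h2].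
  have w0 : w != 0.
    by apply: contraTneq h1 => ->; rewrite bop0E !rnorm0 expr0n mulr0 ltxx.
  have nw : 0 < rnorm w ^+ 2 by rewrite exprn_gt0// rnorm_gt0.
  exists ((rnorm w)^-1%:C *: w).
    by split; [exact: unit_scale|exact: perpZ].
  rewrite bopZ rnormZR ?invr_ge0 ?rnorm_ge0// exprMn exprVn mulrC.
  by rewrite ltr_pdivlMr// h1 /= ltr_pdivrMr.
have [hu'|hu'] := ltP (m * rnorm u ^+ 2) (rnorm (T u) ^+ 2).
  by apply: (nz u) => //; rewrite hu'.
have u0 : u != 0.
  by apply: contraTneq hu => ->; rewrite bop0E !rnorm0 expr0n mulr0 ltxx.
have v0 : v != 0.
  by apply: contraTneq hv => ->; rewrite bop0E !rnorm0 expr0n mulr0 ltxx.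
have nu : 0 < rnorm u ^+ 2 by rewrite exprn_gt0// rnorm_gt0.
have nv : 0 < rnorm v ^+ 2 by rewrite exprn_gt0// rnorm_gt0.
have [d [d0 de dv]] : exists d : R, [/\ 0 < d, d < e &
    (m + d) * rnorm v ^+ 2 < rnorm (T v) ^+ 2].
  pose f := rnorm (T v) ^+ 2 / rnorm v ^+ 2 - m.
  have f0 : 0 < f by rewrite subr_gt0 ltr_pdivlMr.
  exists (Num.min (e / 2) (f / 2)); split.
  - by rewrite lt_min !divr_gt0.
  - by rewrite gt_min; apply/orP; left; lra.
  - rewrite -ltr_pdivlMr// -ltrBrDl -/f gt_min; apply/orP; right; lra.
pose a := rnorm (T u) ^+ 2 - (m + d) * rnorm u ^+ 2.
pose b := rdot (T u) (T v) - (m + d) * rdot u v.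
pose c := rnorm (T v) ^+ 2 - (m + d) * rnorm v ^+ 2.
have c0 : 0 < c by rewrite subr_gt0.
have a0 : a < 0.
  have h := mulr_gt0 d0 nu; rewrite /a; lra.
have D0 : 0 <= b ^+ 2 - a * c.
  by rewrite subr_ge0 (le_trans _ (sqr_ge0 _))// mulr_le0_ge0// ltW.
(* A root of a + 2tb + t^2 c, real because a < 0 < c. There u + s v is nonzero, since u = - s v
   would give a = s^2 c >= 0. *)
pose s := (- b + Num.sqrt (b ^+ 2 - a * c)) / c.
have qE t : rnorm (T (u + t%:C *: v)) ^+ 2 - (m + d) * rnorm (u + t%:C *: v) ^+ 2
    = a + 2 * t * b + t ^+ 2 * c.
  by rewrite bopD bopZ -!rdotxx !rdot_form !rdotxx /a /b /c; ring.
have qs : a + 2 * s * b + s ^+ 2 * c = 0.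
  have h := sqr_sqrtr D0; set r := Num.sqrt _ in h s *.
  have -> : a + 2 * s * b + s ^+ 2 * c = (r ^+ 2 - (b ^+ 2 - a * c)) / c.
    by rewrite /s; field; rewrite gt_eqF.
  by rewrite h subrr mul0r.
have qw := qE s; rewrite qs in qw.
have w0 : u + s%:C *: v != 0.
  apply/eqP => w0; have uE : u = (- s)%:C *: v.
    by apply/eqP; rewrite -subr_eq0 rmorphN scaleNr opprK w0.
  have : a = s ^+ 2 * c.
    by rewrite /a /c uE bopZ -!rdotxx !rdotZl !rdotZr; ring.
  have := mulr_ge0 (sqr_ge0 s) (ltW c0); lra.
apply: (nz (u + s%:C *: v)); first by apply: perpD => //; exact: perpZ.
have nw : 0 < rnorm (u + s%:C *: v) ^+ 2 by rewrite exprn_gt0// rnorm_gt0.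
move/eqP: qw; rewrite subr_eq0 => /eqP ->.
by rewrite !ltr_pM2r// ltrDl d0 ltrD2l.
Qed.

(* Otherwise unit vectors [u_n], orthogonal to the previous [u_k] and [P u_k],
   can be chosen with [|T u_n|^2] greater than [m] and tending to [m]; their closed span
   is diagonalised by [P], and a minimiser on it would be orthogonal to every
   [u_n]. *)
Lemma am_upper_ess (m : R) :
  (forall (e : R) F, 0 < e ->
    exists2 x, perp F x & rnorm (T x) ^+ 2 < (m + e) * rnorm x ^+ 2) ->
  upper_ess m.
Proof.
move=> mlow; apply: contrapT => mup.
have [u uP] : exists u : nat -> V, forall n, rnorm (u n) = 1 /\
    [/\ perp (mkseq u n) (u n), perp (map P (mkseq u n)) (u n) &
      m < rnorm (T (u n)) ^+ 2 < m + (size (mkseq u n)).+1%:R^-1].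
  apply: (@strong_choice _ (fun s x => rnorm x = 1 /\ [/\ perp s x, perp (map P s) x &
     m < rnorm (T x) ^+ 2 < m + (size s).+1%:R^-1])) => s.
  pose G := s ++ map P s.
  have e0 : 0 < (size s).+1%:R^-1 :> R by rewrite invr_gt0.
  have [x xG hx] := mlow _ G e0.
  have [y yG hy] : exists2 y, perp G y & m * rnorm y ^+ 2 < rnorm (T y) ^+ 2.
    apply: contrapT => h; apply: mup; exists G => y yG.
    by rewrite leNgt; apply/negP => hy; apply: h; exists y.
  have [z [z1 /perp_cat[zs zPs]] hz] := value_between e0 xG hx yG hy.
  by exists z.
pose c n := rnorm (T (u n)) ^+ 2.
have uo k n : k != n -> inner (u k) (u n) = 0 /\ inner (u k) (P (u n)) = 0.
  have lt i j : (i < j)%N -> inner (u j) (u i) = 0 /\ inner (u j) (P (u i)) = 0.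
    move=> ij; have [_ [h1 h2 _]] := uP j.
    have im : u i \in mkseq u j by apply/mapP; exists i => //; rewrite mem_iota.
    by split; [exact: h1|apply: h2; exact: map_f].
  rewrite neq_ltn => /orP[kn|nk]; last exact: lt.
  have [h1 h2] := lt _ _ kn; split; first exact: inner0C.
  by rewrite -(symmetric_inner gram_sym); exact: inner0C.
(* The closed span of the u n, encoded as an intersection: z lies in a closed subspace as soon as
   all the u n do. *)
have [L LP] : exists L, forall x, x \in L <->
    forall K : csubspace V, (forall n, u n \in K) -> x \in K.
  apply: csub_exists => [K _|a x y hx hy K uK|l ld K uK]; first exact: rpred0.
    by rewrite rpredD ?rpredZ ?hx ?hy.
  by apply: csub_dist => e /ld[y yK ly]; exists y => //; exact: yK.
have uL n : u n \in L by apply/LP.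
have u0 : u 0%N != 0 by rewrite -rnorm_eq0; have [-> _] := uP 0%N; rewrite oner_eq0.
have [z [zL z1 zm]] := am_min (uL 0%N) u0.
have zm2 y : y \in L -> rnorm (T z) ^+ 2 * rnorm y ^+ 2 <= rnorm (T y) ^+ 2.
  move=> yL; rewrite -exprMn lerXn2r ?nnegrE ?mulr_ge0 ?rnorm_ge0//; exact: zm.
have zle : rnorm (T z) ^+ 2 <= m.
  apply/ler_addgt0Pl => e e0; pose n := Num.truncn e^-1.
  have := zm2 _ (uL n); have [un1 [_ _ /andP[_ h]]] := uP n.
  rewrite un1 expr1n mulr1 => /le_trans; apply; apply: (le_trans (ltW h)).
  rewrite size_mkseq addrC lerD2r -[leRHS]invrK lef_pV2 ?posrE ?invr_gt0//.
  by rewrite ltW// truncnS_gt.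
(* Minimality gives <z, P u_n> = |Tz|^2 <z, u_n>. Also P u_n - c_n u_n is orthogonal to every u_k,
   hence to z, so <z, P u_n> = c_n <z, u_n>; and |Tz|^2 <= m < c_n. *)
have zu n : inner z (u n) = 0.
  have h1 : inner ((P - (rnorm (T z) ^+ 2)%:C *: bop_id V) z) (u n) = 0.
    apply: (csub_rdot_inner (L := L)) => //.
    apply: (form_null (gram_shift_sym _) _ zL) => [y yL|].
      by rewrite rdot_gram_shift subr_ge0 zm2.
    by rewrite rdot_gram_shift z1 expr1n mulr1 subrr.
  have [K KP] := orthogonal_csub [set P (u n) - (c n)%:C *: u n].
  have cJ : Num.conj (c n)%:C = (c n)%:C.
    by apply/conj_Creal/ger0_real; rewrite ler0c sqr_ge0.
  have : z \in K.
    apply: ((LP z).1 zL K) => k; apply/KP => _ ->.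
    have [->|kn] := eqVneq k n; last first.
      have [h2 h3] := uo _ _ kn.
      by rewrite linearBr /= h3 linearZr_LR /= h2 mulr0 subrr.
    have [un1 _] := uP n.
    rewrite linearBr /= linearZr_LR /= inner_xx un1.
    by rewrite -(adjP T) inner_xx expr1n mulr1 [X in _ - X]cJ subrr.
  move=> /KP/(_ _ erefl) /eqP; rewrite linearBr /= linearZr_LR /= [X in _ - X * _]cJ.
  rewrite subr_eq0 => /eqP h2.
  move: h1; rewrite gram_shiftE innerBl innerZl (symmetric_inner gram_sym) h2.
  move/eqP; rewrite -mulrBl -rmorphB mulf_eq0 => /orP[|/eqP//].
  have [_ [_ _ /andP[h _]]] := uP n.
  rewrite -[0]/(0%:C) (inj_eq (@complexI R)) subr_eq0 gt_eqF//.
  exact: le_lt_trans zle h.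
have [K KP] := orthogonal_csub [set z].
have : z \in K.
  by apply: ((LP z).1 zL K) => k; apply/KP => _ ->; exact/inner0C/zu.
move=> /KP/(_ _ erefl)/eqP; rewrite inner_xx_eq0 -rnorm_eq0 z1.
by rewrite oner_eq0.
Qed.

End AbsolutelyMinimumAttaining.

(** * The essential spectrum of |T| *)

Section EssentialSpectrum.
Variables (R : realType) (V : hilbertType R) (T : bop V V).
Implicit Types (x y : V) (F G : seq V) (L : csubspace V).
Hypothesis infV : ~ finite_dimensional [set: V].
Variable m : R.
Hypothesis m0 : 0 <= m.
Hypotheses (mlow : lower_ess T m) (mup : upper_ess T m).

Local Notation P := (adj T ∘ T).
Local Notation S := (abs_bop T).
Local Notation l := (Num.sqrt m).

Lemma abs_sym : symmetric_bop S.
Proof. by have [/positive_bopP[]] := abs_bop_spec T. Qed.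

Lemma abs_ge0 x : 0 <= rdot (S x) x.
Proof. by have [/positive_bopP[_ h] _] := abs_bop_spec T. Qed.

Lemma abs_sqr x : S (S x) = P x.
Proof. by have [_ /bopP/(_ x)] := abs_bop_spec T. Qed.

Lemma rnorm_abs x : rnorm (S x) = rnorm (T x).
Proof.
apply/eqP; rewrite -(@eqrXn2 _ 2)// ?rnorm_ge0//; apply/eqP.
by rewrite -!rdotxx -abs_sym abs_sqr rdot_gram.
Qed.

Lemma gram_shift_small (e : R) : 0 < e ->
  exists F, forall x, perp F x -> rnorm (P x - m%:C *: x) <= e * rnorm x.
Proof.
move=> e0; have [F1 h1] := mlow e0; have [F2 h2] := mup.
pose F := F1 ++ F2.
have [W [WE Ws Wq]] : exists W : bop V V, [/\ forall x, W x = P x - m%:C *: x,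
    symmetric_bop W & forall x, rdot (W x) x = rnorm (T x) ^+ 2 - m * rnorm x ^+ 2].
  exists (P - m%:C *: bop_id V); split=> // [|x]; last exact: rdot_gram_shift.
  exact: gram_shift_sym.
have Wle x : perp F x -> - (e * rnorm x ^+ 2) <= rdot (W x) x <= e * rnorm x ^+ 2.
  move=> /perp_cat[/h1 a1 /h2 a2]; rewrite Wq.
  have := mulr_ge0 (ltW e0) (sqr_ge0 (rnorm x)) => a3; apply/andP; split; lra.
(* The constraints [map W F] keep W x in [perp F], where the bound on the form applies. *)
exists (F ++ map W F) => x /perp_cat[xF xWF]; rewrite -WE.
have WxF : perp F (W x).
  move=> y yF; rewrite (symmetric_inner Ws).
  by apply: xWF; exact: map_f.
(* Subtracting the form bounds at x + y and x - y gives 4 <Wx, y> <= 2e (|x|^2 + |y|^2); for this y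
   it becomes |y| <= |x|, that is, |Wx| <= e |x|. *)
pose y := e^-1%:C *: W x.
have yF : perp F y by exact: perpZ.
have xyF : perp F (x - y) by apply: perpD => //; rewrite -scaleN1r; exact: perpZ.
have /andP[_ h3] := Wle _ (perpD xF yF).
have /andP[h4 _] := Wle _ xyF.
have nW : rnorm (W x) ^+ 2 = e ^+ 2 * rnorm y ^+ 2.
  rewrite /y rnormZR ?invr_ge0 ?ltW// exprMn mulrA -exprMn mulfV ?gt_eqF//.
  by rewrite expr1n mul1r.
have Wxy : rdot (W x) y = e * rnorm y ^+ 2.
  rewrite /y rdotZr rdotxx rnormZR ?invr_ge0 ?ltW// exprMn.
  by field; rewrite gt_eqF.
rewrite -(@ler_pXn2r _ 2)// ?nnegrE ?rnorm_ge0 ?mulr_ge0 ?rnorm_ge0 ?(ltW e0)//.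
rewrite exprMn nW ler_pM2l ?exprn_gt0//.
move: h3 h4; rewrite rnormB2 rnormD2 bopB bopD !(rdotDl, rdotDr, rdotNl, rdotNr).
have -> : rdot (W y) x = rdot (W x) y.
  by rewrite Ws rdotC.
rewrite Wxy => h3 h4.
have h5 : e * rnorm y ^+ 2 <= e * rnorm x ^+ 2 by lra.
by rewrite ler_pM2l in h5.
Qed.

(** If l > 0, P - m = (S + l)(S - l) with S + l >= l, so smallness passes to S - l. If l = 0, |Sx|^2
    = <Px, x>, and P has to be small to order e^2. *)
Lemma abs_shift_small (e : R) : 0 < e ->
  exists F, forall x, perp F x -> rnorm (S x - l%:C *: x) <= e * rnorm x.
Proof.
move=> e0; have [l0|l0] := eqVneq l 0.
  have [F FP] := gram_shift_small (exprn_gt0 2 e0).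
  have mz : m = 0 by rewrite -(sqr_sqrtr m0) l0 expr0n.
  exists F => x /FP; rewrite l0 mz !scale0r !subr0 => h.
  rewrite -(@ler_pXn2r _ 2)// ?nnegrE ?rnorm_ge0 ?mulr_ge0 ?rnorm_ge0 ?(ltW e0)//.
  rewrite -rdotxx -abs_sym abs_sqr exprMn (le_trans (rdot_le _ _))//.
  by rewrite (expr2 (rnorm x)) mulrA ler_wpM2r ?rnorm_ge0.
have lp : 0 < l by rewrite lt_neqAle eq_sym l0 sqrtr_ge0.
have [F FP] := gram_shift_small (mulr_gt0 lp e0).
exists F => x /FP h; set v := S x - l%:C *: x.
have vE : P x - m%:C *: x = S v + l%:C *: v.
  rewrite /v bopB bopZ abs_sqr scalerBr scalerA -rmorphM -expr2 sqr_sqrtr//.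
  by rewrite addrA subrK.
have h1 : l * rnorm v ^+ 2 <= l * (e * rnorm x) * rnorm v.
  rewrite (mulrA l e); apply: (@le_trans _ _ (rdot (S v + l%:C *: v) v)).
    by rewrite rdotDl rdotZl rdotxx lerDr abs_ge0.
  rewrite -vE (le_trans (rdot_le _ _))// ler_wpM2r ?rnorm_ge0//.
have [->|v0] := eqVneq v 0; first by rewrite rnorm0 mulr_ge0 ?rnorm_ge0 ?ltW.
by move: h1; rewrite -mulrA ler_pM2l// expr2 ler_pM2r// rnorm_gt0.
Qed.

Lemma ess_spectrum_abs : ess_spectrum S = [set l%:C].
Proof.
apply/seteqP; split=> [z zS|_ ->] /=; last first.
  move=> [Q [+ _]]; rewrite /calkin_eq.
  have [M M0 QM] := bop_gt0_bounded Q.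
  (* As |Qx| <= M |x|, this gives |(S - l) Q x| <= |x| / 2 in finite codimension, so (S - l) Q - 1
     is bounded below there and is not compact. *)
  have e0 : 0 < (2 * M)^-1 by rewrite invr_gt0 mulr_gt0.
  have [F FP] := abs_shift_small e0.
  have h2 : 0 < 2^-1 :> R by rewrite invr_gt0.
  apply: (compact_not_bounded_below (F := map (adj Q) F) infV h2) => x xF.
  have QxF : perp F (Q x) by move=> y yF; rewrite adjP; apply: xF; exact: map_f.
  have h := FP _ QxF.
  have {}h : rnorm (S (Q x) - l%:C *: Q x) <= 2^-1 * rnorm x.
    rewrite (le_trans h)// invfM -mulrA ler_wpM2l//.
    by rewrite mulrC ler_pdivrMr// mulrC.
  change (2^-1 * rnorm x <= rnorm (S (Q x) - l%:C *: Q x - x)).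
  have := rnormD (S (Q x) - l%:C *: Q x) (x - (S (Q x) - l%:C *: Q x)).
  rewrite addrC subrK (rnormB x); lra.
(* The scalar k inverts S - z modulo compact operators, because k (S - z) - 1 = k (S - l). *)
apply: contrapT => zl; apply: zS; pose k := (l%:C - z)^-1.
have kz : k * (l%:C - z) = 1.
  by rewrite mulVf// subr_eq0; apply/eqP => h; apply: zl; rewrite h.
have small (K : bop V V) : (forall x, K x = k *: (S x - l%:C *: x)) -> compact_bop K.
  move=> KE; apply: compact_of_small => e e0.
  have k0 : 0 <= complex.Re `|k| by rewrite -ler0c RRe_real// ger0_real.
  have k1 : 0 < complex.Re `|k| + 1 by rewrite ltr_wpDl.
  have [F FP] := abs_shift_small (divr_gt0 e0 k1).
  exists F => x /FP h; rewrite KE rnormZ.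
  apply: (@le_trans _ _ ((complex.Re `|k| + 1) * (e / (complex.Re `|k| + 1) * rnorm x))).
    by rewrite ler_pM ?rnorm_ge0// lerDl.
  by rewrite mulrA mulrCA mulfV ?mulr1// gt_eqF.
have kx x : k *: (S x - z *: x) - x = k *: (S x - l%:C *: x).
  have xE : x = (k * (l%:C - z)) *: x by rewrite kz scale1r.
  rewrite [X in _ - X]xE mulrBr scalerBl !scalerBr !scalerA opprB.
  by rewrite addrA subrK.
exists (k *: bop_id V); split; apply: small => x; rewrite -kx//.
change (S (k *: x) - z *: (k *: x) - x = k *: (S x - z *: x) - x).
by rewrite bopZ scalerBr !scalerA (mulrC z).
Qed.

End EssentialSpectrum.

(** * Norm bounds orthogonal to the eigenvectors of P *)

Section Diagonalisation.
Variables (R : realType) (V : hilbertType R) (T : bop V V).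
Implicit Types (x y : V) (F G : seq V) (L : csubspace V).
Hypothesis Tam : absolutely_min_attaining T.

Local Notation P := (adj T ∘ T).

Fixpoint gram_pow (n : nat) : bop V V :=
  if n is k.+1 then P ∘ gram_pow k else bop_id V.

Lemma gram_powS n x : gram_pow n.+1 x = P (gram_pow n x).
Proof. by []. Qed.

Lemma gram_powSr n x : gram_pow n.+1 x = gram_pow n (P x).
Proof. by elim: n => [//|n IH]; rewrite gram_powS IH. Qed.

Lemma gram_pow_convex n x : rnorm (gram_pow n.+1 x) ^+ 2 <=
  rnorm (gram_pow n x) * rnorm (gram_pow n.+2 x).
Proof.
rewrite -rdotxx {1}gram_powS gram_sym -gram_powS.
exact: rdot_le.
Qed.

Lemma bernoulli (h : R) n : 0 <= h -> 1 + h *+ n <= (1 + h) ^+ n.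
Proof.
move=> h0; elim: n => [|n IH]; first by rewrite expr0 addr0.
have h1 : 1 <= (1 + h) ^+ n by rewrite exprn_ege1// lerDl.
have h2 : h <= h * (1 + h) ^+ n by rewrite ler_peMr.
have -> : (1 + h) ^+ n.+1 = (1 + h) ^+ n + h * (1 + h) ^+ n.
  by rewrite exprS [LHS]mulrDl mul1r.
by rewrite (mulrSr h) addrA lerD.
Qed.

(* If [|P x| > c |x|], log-convexity makes [|P^n x|] grow faster than [c^n]. *)
Lemma gram_spectral_radius (c C : R) x : 0 <= c ->
  (forall n, rnorm (gram_pow n x) <= C * c ^+ n) -> rnorm (P x) <= c * rnorm x.
Proof.
move=> c0 hC; rewrite leNgt; apply/negP => hx.
have x0 : 0 < rnorm x.
  rewrite rnorm_gt0; apply: contraTneq hx => ->.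
  by rewrite bop0E !rnorm0 mulr0 ltxx.
pose r := rnorm (P x) / rnorm x.
have cr : c < r by rewrite /r ltr_pdivlMr.
have r0 : 0 < r by exact: le_lt_trans cr.
have grow n : 0 < rnorm (gram_pow n x) /\
    r * rnorm (gram_pow n x) <= rnorm (gram_pow n.+1 x).
  elim: n => [|n [p0 IH]].
    by split=> //=; rewrite /r mulfVK// gt_eqF.
  have p1 : 0 < rnorm (gram_pow n.+1 x) by rewrite (lt_le_trans _ IH)// mulr_gt0.
  split=> //; rewrite -(ler_pM2l p0) (le_trans _ (gram_pow_convex n x))//.
  by rewrite expr2 mulrA ler_wpM2r ?(ltW p1)// mulrC.
have pow n : r ^+ n * rnorm x <= rnorm (gram_pow n x).
  elim: n => [|n IH]; first by rewrite expr0 mul1r.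
  have [_ h] := grow n; rewrite (le_trans _ h)// exprS -mulrA.
  by rewrite ler_wpM2l// ltW.
have [c1|c1] := eqVneq c 0.
  have := le_trans (pow 1) (hC 1); rewrite c1 !expr1 mulr0 leNgt.
  by rewrite mulr_gt0.
have cp : 0 < c by rewrite lt_neqAle eq_sym c1.
have h0 : 0 < r / c - 1 by rewrite subr_gt0 ltr_pdivlMr// mul1r.
set h := r / c - 1 in h0.
have key n : (1 + h *+ n) * rnorm x <= C.
  apply: (@le_trans _ _ ((1 + h) ^+ n * rnorm x)).
    by rewrite ler_wpM2r ?rnorm_ge0// bernoulli// ltW.
  rewrite /h addrCA subrr addr0 expr_div_n mulrAC ler_pdivrMr ?exprn_gt0//.
  exact: le_trans (pow n) (hC n).
pose n := Num.truncn (C / (h * rnorm x)).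
have := key n.+1; rewrite leNgt => /negP; apply.
have : C / (h * rnorm x) < n.+1%:R by exact: truncnS_gt.
rewrite ltr_pdivrMr ?mulr_gt0// => hn; apply: (lt_le_trans hn).
have -> : (1 + h *+ n.+1) * rnorm x = rnorm x + n.+1%:R * (h * rnorm x).
  by rewrite -(mulr_natl h); ring.
by rewrite lerDr ltW.
Qed.

(** The constant C improves itself to |x|; this is why the vectors with such a growth bound are
    closed under addition in [gram_below]. *)
Lemma gram_pow_bound (c C : R) x : 0 <= c ->
  (forall n, rnorm (gram_pow n x) <= C * c ^+ n) ->
  forall n, rnorm (gram_pow n x) <= c ^+ n * rnorm x.
Proof.
move=> c0 hC; elim=> [|n IH]; first by rewrite mul1r.
rewrite exprS -mulrA; apply: (@le_trans _ _ (c * rnorm (gram_pow n x))).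
  apply: (@gram_spectral_radius _ (C * c ^+ n)) => // k.
  have -> : gram_pow k (gram_pow n x) = gram_pow (k + n) x.
    by elim: k => [//|k IHk]; rewrite gram_powS IHk.
  by rewrite -mulrA -exprD addnC.
by rewrite ler_wpM2l.
Qed.

Definition above_eigenvectors (c : R) : set V :=
  [set y | exists2 b : R, c < b & P y = b%:C *: y].

Lemma inner_eigen (b : R) x y : P y = b%:C *: y -> inner (P x) y = b%:C * inner x y.
Proof.
move=> Py; rewrite (symmetric_inner (@gram_sym _ _ T)) Py linearZr_LR /=.
have bJ : Num.conj b%:C = b%:C by apply/conj_Creal/complex_realP; exists b.
by rewrite [X in X * _]bJ.
Qed.

Lemma eigen_orthogonal (b c : R) x y : P x = b%:C *: x -> P y = c%:C *: y ->
  b != c -> inner x y = 0.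
Proof.
move=> Px Py bc; have := inner_eigen x Py; rewrite Px innerZl => /eqP.
rewrite -subr_eq0 -mulrBl mulf_eq0 => /orP[|/eqP//].
by rewrite subr_eq0 (inj_eq (@complexI R)) (negbTE bc).
Qed.

Lemma below_invariant (c : R) x :
  (forall y, above_eigenvectors c y -> inner x y = 0) ->
  forall y, above_eigenvectors c y -> inner (P x) y = 0.
Proof.
move=> h y yc; have [b _ Py] := yc.
by rewrite (inner_eigen _ Py) h// mulr0.
Qed.

(** The vectors of L with |P^n y| <= c^n |y| for all n form a closed P-invariant subspace E. If E
    were not all of L, its complement in L would contain an eigenvector: with eigenvalue at most c
    it lies in E, with a larger one it is orthogonal to itself. *)
Lemma gram_below (c : R) x : 0 <= c ->
  (forall y, above_eigenvectors c y -> inner x y = 0) ->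
  rnorm (P x) <= c * rnorm x.
Proof.
move=> c0.
have [L LP] := orthogonal_csub (above_eigenvectors c).
have sharp y C : (forall n, rnorm (gram_pow n y) <= C * c ^+ n) ->
  forall n, rnorm (gram_pow n y) <= c ^+ n * rnorm y by exact: gram_pow_bound.
have [E EP] : exists E : csubspace V, forall y, y \in E <->
    y \in L /\ forall n, rnorm (gram_pow n y) <= c ^+ n * rnorm y.
  apply: csub_exists => [|a y z [yL yE] [zL zE]|y yd].
  - by split=> [|n]; [exact: rpred0|rewrite bop0E !rnorm0 mulr0].
  - split; first by rewrite rpredD// rpredZ.
    apply: (sharp _ (complex.Re `|a| * rnorm y + rnorm z)) => n.
    rewrite linearP (le_trans (rnormD _ _))// rnormZ mulrDl lerD//; last by rewrite mulrC zE.
    rewrite -mulrA ler_wpM2l//; last by rewrite mulrC yE.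
    by rewrite -ler0c RRe_real// ger0_real.
  - split; first by apply: csub_dist => e /yd[z [zL _]]; exists z.
    move=> n; rewrite -subr_le0.
    have [M M0 nM] := bop_gt0_bounded (gram_pow n).
    apply: (csub_dist_approx (c := M + c ^+ n)
      (f := fun y => rnorm (gram_pow n y) - c ^+ n * rnorm y) _ _ yd).
      move=> u v.
      have h1 : rnorm (gram_pow n u) <= rnorm (gram_pow n v) + M * rnorm (u - v).
        rewrite -{1}(subrK v u) addrC bopD (le_trans (rnormD _ _))// lerD2l.
        exact: nM.
      have h2 : rnorm v <= rnorm u + rnorm (u - v).
        by rewrite -{1}(subrK u v) addrC rnormB (le_trans (rnormD _ _)).
      have h3 := ler_wpM2l (exprn_ge0 n c0) h2; lra.
    by move=> z [_ zE]; rewrite subr_le0.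
have EPinv y : y \in E -> P y \in E.
  move=> /EP[yL yE]; apply/EP; split.
    by apply/LP/below_invariant; exact/LP.
  apply: (sharp _ (c * rnorm y)) => n.
  by rewrite -gram_powSr (le_trans (yE _))// exprS mulrAC.
have [E' E'P] := orthogonal_csub [set` E].
have [K KP] := csubI L E'.
have KPinv y : y \in K -> P y \in K.
  move=> /KP[yL yE']; apply/KP; split.
    by apply/LP/below_invariant; exact/LP.
  apply/E'P => z zE; rewrite (symmetric_inner (@gram_sym _ _ T)).
  by move/E'P : yE'; apply; exact: EPinv.
move=> /LP xL; suff /EP[_ /(_ 1%N)] : x \in E by rewrite expr1.
apply: (csub_eq_of_perp0 (M := L)) xL => [y /EP[]//|y yL yE].
apply/eqP; apply: contrapT => /negP y0.
have yK : y \in K.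
  by apply/KP; split=> //; apply/E'P => z zE; apply: (csub_rdot_inner yE).
have [z [b [zK z1 b0 Pz _]]] := am_eigenvector Tam KPinv yK y0.
have [zL /E'P zE'] := (KP z).1 zK.
have : inner z z = 0.
  have [bc|cb] := leP b c.
    apply: zE'; apply/EP; split=> // n.
    have -> : gram_pow n z = (b ^+ n)%:C *: z.
      elim: n => [|n IH]; first by rewrite scale1r.
      by rewrite gram_powS IH bopZ Pz scalerA -rmorphM exprSr.
    by rewrite rnormZR ?exprn_ge0// ler_wpM2r ?rnorm_ge0// lerXn2r.
  by move/LP : zL; apply; exists b.
by move/eqP; rewrite inner_xx_eq0 -rnorm_eq0 z1 oner_eq0.
Qed.

Lemma op_below (c : R) x : 0 <= c ->
  (forall y, above_eigenvectors c y -> inner x y = 0) ->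
  rnorm (T x) ^+ 2 <= c * rnorm x ^+ 2.
Proof.
move=> c0 /(gram_below c0) h; rewrite -rdot_gram_xx (le_trans (rdot_le _ _))//.
by rewrite (expr2 (rnorm x)) mulrA ler_wpM2r ?rnorm_ge0.
Qed.

End Diagonalisation.

Lemma null_spaceP (R : realType) (V W : hilbertType R) (S : bop V W) x :
  x \in null_space S <-> S x = 0.
Proof.
by split=> [h|h]; [apply/eqP; exact: h|change (is_true (S x == 0)); apply/eqP].
Qed.

(** * Finiteness of the spectral part above m *)

Section FiniteTop.
Variables (R : realType) (V : hilbertType R) (T : bop V V).
Implicit Types (x y : V) (F G : seq V) (L : csubspace V).
Hypothesis Tam : absolutely_min_attaining T.
Variable m : R.
Hypothesis mup : upper_ess T m.

Local Notation P := (adj T ∘ T).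

Definition eigenvalue_above (b : R) := m < b /\ exists2 y, y != 0 & P y = b%:C *: y.

(** K is the closed span of the eigenvectors above m. If nonzero, it contains a minimiser, with
    eigenvalue b > m, so |Tx|^2 >= b |x|^2 on K; on some [perp G] the opposite bound by m holds, so
    the two meet in 0. *)
Lemma top_subspace : exists L K : csubspace V,
  [/\ forall x, x \in L <-> forall y, above_eigenvectors T m y -> inner x y = 0,
      forall x, x \in K <-> forall y, y \in L -> inner x y = 0 &
      exists G, forall x, x \in K -> perp G x -> x = 0].
Proof.
have [L LP] := orthogonal_csub (above_eigenvectors T m).
have [K KP] := orthogonal_csub [set` L].
exists L, K; split=> //.
have [G GP] := mup; exists G => x xK /GP xG.
apply/eqP; apply: contrapT => /negP x0.
have KPinv y : y \in K -> P y \in K.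
  move=> /KP yK; apply/KP => z zL; rewrite (symmetric_inner (@gram_sym _ _ T)).
  by apply: yK; apply/LP/below_invariant; exact/LP.
have [z [b [zK z1 b0 Pz zm]]] := am_eigenvector Tam KPinv xK x0.
have mb : m < b.
  rewrite ltNge; apply/negP => bm.
  have : inner z z = 0.
    move/KP : zK; apply; apply/LP => y [c mc Py].
    by apply: (eigen_orthogonal Pz Py); rewrite lt_eqF// (le_lt_trans bm).
  by move/eqP; rewrite inner_xx_eq0 -rnorm_eq0 z1 oner_eq0.
have := le_trans (zm _ xK) xG; rewrite leNgt => /negP; apply.
by rewrite ltr_pM2r// exprn_gt0// rnorm_gt0.
Qed.

(** Infinitely many distinct eigenvalues would give an orthogonal family in K longer than [size G].
    The case n = 0 covers an empty top part. *)
Lemma eigenvalue_list : exists n (a : 'I_n -> R), injective a /\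
  forall b, eigenvalue_above b <-> exists i, a i = b.
Proof.
have [L [K [LP KP [G GP]]]] := top_subspace.
have [s sP] : exists s : seq R, forall b, eigenvalue_above b -> b \in s.
  apply: contrapT => nos.
  have [u uP] : exists u : nat -> R, forall n,
      eigenvalue_above (u n) /\ u n \notin mkseq u n.
    apply: (@strong_choice _ (fun s b => eigenvalue_above b /\ b \notin s)) => s.
    apply: contrapT => h; apply: nos; exists s => b bA.
    by apply: contrapT => /negP bs; apply: h; exists b.
  have uinj i j : (i < j)%N -> u i != u j.
    move=> ij; have [_ h] := uP j; apply: contraNneq h => <-.
    by apply/mapP; exists i => //; rewrite mem_iota.
  have /choice[v vP] : forall n, exists y, y != 0 /\ P y = (u n)%:C *: y.
    by move=> n; have [[_ [y y0 Py]] _] := uP n; exists y.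
  suff : ((size G).+1 <= size G)%N by rewrite ltnn.
  apply: (orthogonal_family_bound (P := fun x => x \in K) (v := fun i : 'I_(size G).+1 => v i) _ GP).
  - move=> c; apply: rpred_sum => i _; apply: rpredZ; apply/KP => y /LP yL.
    apply: inner0C; apply: yL; exists (u i); first by have [[]] := uP i.
    by have [] := vP i.
  - by move=> i; have [] := vP i.
  - move=> i j ij; have [_ Pi] := vP i; have [_ Pj] := vP j.
    apply: (eigen_orthogonal Pi Pj); move: ij; rewrite -val_eqE neq_ltn => /orP[] h.
      exact: uinj.
    by rewrite eq_sym uinj.
pose t := undup [seq b <- s | `[< eigenvalue_above b >]].
exists (size t), (fun i => nth 0 t i); split.
  by move=> i j /eqP; rewrite nth_uniq ?undup_uniq// => /eqP; exact: val_inj.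
have tP b : b \in t <-> eigenvalue_above b.
  rewrite mem_undup mem_filter; split=> [/andP[/asboolP//]|h].
  by apply/andP; split; [exact/asboolP|exact: sP].
move=> b; split=> [/tP bt|[i <-]].
  have it : (index b t < size t)%N by rewrite index_mem.
  by exists (Ordinal it); rewrite /= nth_index.
by apply/tP; exact: mem_nth.
Qed.

(** Removing from x its projections on the eigenspaces leaves a vector of K orthogonal to all
    eigenvectors above m, thus in L as well, hence 0. *)
Lemma top_decomposition n (a : 'I_n -> R) L (K : csubspace V) : injective a ->
  (forall b, eigenvalue_above b <-> exists i, a i = b) ->
  (forall x, x \in L <-> forall y, above_eigenvectors T m y -> inner x y = 0) ->
  (forall x, x \in K <-> forall y, y \in L -> inner x y = 0) ->
  forall x, x \in K <-> exists2 v : 'I_n -> V,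
    forall i, P (v i) = (a i)%:C *: v i & x = \sum_i v i.
Proof.
move=> ainj aP LP KP x.
have inK i y : P y = (a i)%:C *: y -> y \in K.
  move=> Py; apply/KP => z /LP zL; apply: inner0C; apply: zL; exists (a i) => //.
  by have /aP[] : exists j, a j = a i by exists i.
split=> [xK|[v vP ->]]; last by rewrite rpred_sum// => i _; exact: (inK i).
pose N i := null_space (P - (a i)%:C *: bop_id V).
have NP i y : y \in N i <-> P y = (a i)%:C *: y.
  split=> [/null_spaceP/eqP|Py]; first by rewrite gram_shiftE subr_eq0 => /eqP.
  by apply/null_spaceP; rewrite gram_shiftE Py subrr.
have /choice[p pP] : forall i, exists p, p \in N i /\
    forall y, y \in N i -> rdot (x - p) y = 0 by move=> i; exact: projection.
exists p; first by move=> i; apply/NP; have [] := pP i.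
apply/eqP; rewrite -subr_eq0 -inner_xx_eq0; apply/eqP.
have dK : x - \sum_i p i \in K.
  by rewrite rpredB// rpred_sum// => i _; apply: (inK i); apply/NP; have [] := pP i.
move/KP : (dK); apply; apply/LP => y [b mb Py].
have [->|y0] := eqVneq y 0; first by rewrite linear0r.
have [i ai] : exists i, a i = b by apply/aP; split=> //; exists y.
rewrite (bigD1 i)//= opprD addrA innerBl.
have [_ h] := pP i; rewrite (csub_rdot_inner h); last by apply/NP; rewrite ai.
rewrite sub0r inner_suml big1 ?oppr0// => j ji.
have /NP Pj : p j \in N j by have [] := pP j.
by apply: (eigen_orthogonal Pj Py); rewrite -ai (inj_eq ainj).
Qed.

End FiniteTop.

(** * Invariance of maximal eigenspaces *)

Section Reducing.
Variables (R : realType) (V : hilbertType R) (T : bop V V).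
Implicit Types (x y : V) (F G : seq V) (L : csubspace V).
Hypothesis Tam : absolutely_min_attaining T.
Hypothesis Tsp : star_paranormal T.

Local Notation P := (adj T ∘ T).

(* On [L] the norm of [T] is at most [c]; *-paranormality at [T x] gives
   [c^4 |x|^2 = |T^* T x|^2 <= |T^3 x| |T x| <= c^2 |T^2 x| |x|], so [T x] is
   again a maximal vector. *)
Lemma max_eigenspace_invariant L (c : R) x : 0 <= c ->
  (forall y, y \in L -> T y \in L) -> (forall y, y \in L -> adj T y \in L) ->
  (forall y, y \in L -> rnorm (T y) ^+ 2 <= c * rnorm y ^+ 2) ->
  x \in L -> P x = c%:C *: x -> P (T x) = c%:C *: T x.
Proof.
move=> c0 TL TaL Tc xL Px.
have Tx : rnorm (T x) ^+ 2 = c * rnorm x ^+ 2.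
  by rewrite -rdot_gram_xx Px rdotZl rdotxx.
have TTx : c * rnorm (T x) ^+ 2 <= rnorm (T (T x)) ^+ 2.
  have [Tx0|Tx0] := eqVneq (T x) 0; first by rewrite Tx0 bop0E rnorm0 expr0n mulr0.
  have x0 : x != 0 by apply: contra_neq Tx0 => ->; rewrite bop0E.
  have nx : 0 < rnorm x ^+ 2 by rewrite exprn_gt0// rnorm_gt0.
  have nTx : 0 < rnorm (T x) ^+ 2 by rewrite exprn_gt0// rnorm_gt0.
  have cp : 0 < c by rewrite -(pmulr_lgt0 _ nx) -Tx.
  have h1 := Tsp (T x).
  have aTx : adj T (T x) = c%:C *: x by [].
  rewrite aTx rnormZR// in h1.
  have h2 : (c * rnorm x) ^+ 2 = c * rnorm (T x) ^+ 2 by rewrite exprMn Tx; ring.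
  have h3 := Tc _ (TL _ (TL _ xL)).
  rewrite h2 in h1.
  have h4 : (c * rnorm (T x) ^+ 2) ^+ 2 <=
      c * rnorm (T (T x)) ^+ 2 * rnorm (T x) ^+ 2.
    apply: (@le_trans _ _ ((rnorm (T (T (T x))) * rnorm (T x)) ^+ 2)).
      by rewrite lerXn2r ?nnegrE ?mulr_ge0 ?rnorm_ge0 ?sqr_ge0.
    by rewrite exprMn ler_wpM2r ?sqr_ge0.
  have h5 : (c * rnorm (T x) ^+ 2) * (c * rnorm (T x) ^+ 2) <=
      rnorm (T (T x)) ^+ 2 * (c * rnorm (T x) ^+ 2).
    by rewrite -expr2 (le_trans h4)// [leRHS]mulrCA mulrA.
  by move: h5; rewrite ler_pM2r// mulr_gt0.
apply/eqP; rewrite -subr_eq0; apply/eqP.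
pose W := c%:C *: bop_id V - P.
have WE y : W y = c%:C *: y - P y by [].
have Ws : symmetric_bop W.
  by move=> y z; rewrite !WE rdotBl rdotBr rdotZl rdotZr gram_sym.
have Wq y : rdot (W y) y = c * rnorm y ^+ 2 - rnorm (T y) ^+ 2.
  by rewrite WE rdotBl rdotZl rdotxx rdot_gram_xx.
have TxL := TL _ xL.
have WTx : W (T x) \in L by rewrite WE rpredB// ?rpredZ// TaL// TL.
have : rdot (W (T x)) (W (T x)) = 0.
  apply: (form_null Ws (L := L)) => // [y yL|]; first by rewrite Wq subr_ge0 Tc.
  by rewrite Wq; apply/eqP; rewrite subr_eq0 eq_le TTx Tc.
rewrite rdotxx => /eqP; rewrite sqrf_eq0 rnorm_eq0 => /eqP Wz.
by rewrite -opprB -WE Wz oppr0.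
Qed.

(* Wold: a vector [w] of [N] orthogonal to [T N] would generate the infinite
   orthogonal sequence [w, T w, T^2 w, ...] in [N]. *)
Lemma finite_isometric_onto L G (c : R) : 0 < c ->
  (forall x, x \in L -> perp G x -> x = 0) ->
  (forall x, x \in L -> P x = c%:C *: x) -> (forall x, x \in L -> T x \in L) ->
  forall x, x \in L -> exists2 y, y \in L & T y = x.
Proof.
move=> c0 LG LP TL.
have wold w : w \in L -> (forall y, y \in L -> inner w (T y) = 0) -> w = 0.
  move=> wL wT; apply/eqP; apply: contrapT => /negP w0.
  pose v n := iter n T w.
  have vL n : v n \in L by elim: n => [//|n IH] /=; exact: TL.
  have v0 n : v n != 0.
    elim: n => [//|n IH] /=; apply/eqP => Tv.
    have := LP _ (vL n); rewrite /= Tv bop0E => /esym/eqP.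
    rewrite scaler_eq0 (negbTE IH) orbF -[0]/(0%:C) (inj_eq (@complexI R)).
    by rewrite gt_eqF.
  have vo i j : (i < j)%N -> inner (v i) (v j) = 0.
    elim: i j => [|i IH] [//|j] ij; first exact: wT.
    rewrite /= adjP; have -> : adj T (T (v j)) = c%:C *: v j by exact: LP.
    by rewrite linearZr_LR /= IH// mulr0.
  suff : ((size G).+1 <= size G)%N by rewrite ltnn.
  apply: (orthogonal_family_bound (P := fun x => x \in L) (v := fun i : 'I_(size G).+1 => v i) _ LG).
  - by move=> d; rewrite rpred_sum// => i _; rewrite rpredZ.
  - by move=> i; exact: v0.
  - move=> i j; rewrite -val_eqE neq_ltn => /orP[|] h; first exact: vo.
    exact/inner0C/vo.
move=> x xL; have [p [pL pP]] := projection L (adj T x).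
pose y := (c^-1)%:C *: p.
have yL : y \in L by rewrite rpredZ.
have yP z : z \in L -> inner (x - T y) (T z) = 0.
  move=> zL; rewrite innerBl -(adjK T) -!adjP adjK.
  have -> : adj T (T y) = p.
    by rewrite -[LHS]/(P y) (LP y yL) /y scalerA -rmorphM mulfV ?scale1r ?gt_eqF.
  by rewrite -innerBl; apply: (csub_rdot_inner pP).
exists y => //; have : x - T y = 0 by apply: wold => //; rewrite rpredB// TL.
by move/eqP; rewrite subr_eq0 => /eqP.
Qed.

(** By surjectivity x = T y with y in L, and then [adj T x] = P y = c y. *)
Lemma eigenspace_adj L G (c : R) : 0 < c ->
  (forall x, x \in L -> perp G x -> x = 0) ->
  (forall x, x \in L -> P x = c%:C *: x) -> (forall x, x \in L -> T x \in L) ->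
  forall x, x \in L -> adj T x \in L /\ T (adj T x) = c%:C *: x.
Proof.
move=> c0 LG LP TL x xL.
have [y yL <-] := finite_isometric_onto c0 LG LP TL xL.
have -> : adj T (T y) = c%:C *: y by exact: LP.
by rewrite bopZ; split=> //; exact: rpredZ.
Qed.

End Reducing.

(** * Blocks *)

Section SubHilbert.
Variables (R : realType) (H : hilbertType R).
Implicit Types (L M : csubspace H).

Lemma val_subhilbD L (x y : subhilb L) : val (x + y) = val x + val y.
Proof. by []. Qed.

Lemma val_subhilbZ L (a : R[i]) (x : subhilb L) : val (a *: x) = a *: val x.
Proof. by []. Qed.

Lemma val_subhilb0 L : val (0 : subhilb L) = 0.
Proof. by []. Qed.

Lemma val_subhilb_sum L (I : Type) (r : seq I) (P : pred I) (F : I -> subhilb L) :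
  val (\sum_(i <- r | P i) F i) = \sum_(i <- r | P i) val (F i).
Proof. by elim/big_rec2: _ => // i y1 y2 _ <-. Qed.

Lemma rdot_subhilb L (x y : subhilb L) : rdot x y = rdot (val x) (val y).
Proof. by []. Qed.

Lemma rnorm_subhilb L (x : subhilb L) : rnorm x = rnorm (val x).
Proof. by []. Qed.

Lemma compression L M (S : bop H H) :
  exists S' : bop (subhilb L) (subhilb M), forall (x : subhilb L) (y : subhilb M),
    rdot (val (S' x)) (val y) = rdot (S (val x)) (val y).
Proof.
have /choice[f fP] : forall x : subhilb L, exists z : subhilb M,
    forall y, y \in M -> rdot (S (val x) - val z) y = 0.
  by move=> x; have [p [pM pP]] := projection M (S (val x)); exists (SubHilb pM).
have fE x (y : subhilb M) : rdot (val (f x)) (val y) = rdot (S (val x)) (val y).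
  have := fP x (val y) (valP y); rewrite rdotBl => /eqP.
  by rewrite subr_eq0 => /eqP.
have fI x (y : subhilb M) : inner (val (f x)) (val y) = inner (S (val x)) (val y).
  apply: inner_eq_rdot; first exact: fE.
  by rewrite !rdotiC -val_subhilbZ fE.
have lin : linear f.
  move=> a x y; apply: rdot_inj => z; rewrite !(rdotC z) /rdot; congr complex.Re.
  change (inner (val (f (a *: x + y))) (val z) =
    inner (a *: val (f x) + val (f y)) (val z)).
  rewrite linearPl /= !fI.
  by rewrite val_subhilbD val_subhilbZ linearP linearPl.
have bnd : exists C : R, forall x, rnorm (f x) <= C * rnorm x.
  have [C C0 SC] := bop_gt0_bounded S; exists C => x.
  rewrite (le_trans _ (SC (val x)))//; apply: rnorm_le_dual; first exact: rnorm_ge0.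
  by move=> y; rewrite rdot_subhilb fE rdot_le.
by exists (Bop lin bnd).
Qed.

Lemma restriction L M (S : bop H H) : (forall x, x \in L -> S x \in M) ->
  exists S' : bop (subhilb L) (subhilb M), forall x, val (S' x) = S (val x).
Proof.
move=> SLM; have [S' S'P] := compression L M S; exists S' => x.
have xM := SLM _ (valP x).
have -> : S (val x) = val (SubHilb xM) by [].
congr val; apply: rdot_inj => y.
by rewrite !(rdotC y) [LHS]S'P.
Qed.

Lemma finite_rank_subhilb L (W : hilbertType R) (S : bop (subhilb L) W) :
  finite_dimensional [set` L] -> finite_rank S.
Proof.
move=> [n [e LE]].
have /choice[f fP] : forall i, exists z : subhilb L, val z = e i.
  move=> i; have eL : e i \in L.
    have : [set \sum_i c i *: e i | c in [set: 'I_n -> R[i]]] (e i).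
      exists (fun j => (j == i)%:R) => //; rewrite (bigD1 i)//= eqxx scale1r.
      by rewrite big1 ?addr0// => j /negbTE ->; rewrite scale0r.
    by rewrite -LE.
  by exists (SubHilb eL).
exists n, (fun i => S (f i)); apply/seteqP; split=> y /=.
  move=> [x _ <-]; have : [set` L] (val x) := valP x.
  rewrite LE => -[c _ cx]; exists c => //.
  have -> : x = \sum_i c i *: f i.
    apply: val_inj; rewrite val_subhilb_sum -cx; apply: eq_bigr => i _.
    by rewrite val_subhilbZ fP.
  by rewrite linear_sum; apply: eq_bigr => i _; rewrite linearZ.
move=> [c _ <-]; exists (\sum_i c i *: f i) => //.
by rewrite linear_sum; apply: eq_bigr => i _; rewrite linearZ.
Qed.

End SubHilbert.

(** * Descent through the eigenvalues above m *)

Section TopPart.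
Variables (R : realType) (V : hilbertType R) (T : bop V V).
Implicit Types (x y : V) (F G : seq V) (L : csubspace V).
Hypothesis Tam : absolutely_min_attaining T.
Hypothesis Tsp : star_paranormal T.
Variable m : R.
Hypotheses (m0 : 0 <= m) (mup : upper_ess T m).

Local Notation P := (adj T ∘ T).

(** Trivially true when b is not an eigenvalue of P, so the descent can range over all reals. The
    last equation says T adj T = P on the eigenspace, the source of unitarity and normality. *)
Definition reducing_eigenvalue (b : R) := forall x, P x = b%:C *: x ->
  [/\ P (T x) = b%:C *: T x, P (adj T x) = b%:C *: adj T x & T (adj T x) = b%:C *: x].

Lemma below_reducing (c : R) :
  (forall b, c < b -> reducing_eigenvalue b) ->
  forall x, (forall y, above_eigenvectors T c y -> inner x y = 0) ->
  (forall y, above_eigenvectors T c y -> inner (T x) y = 0) /\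
  (forall y, above_eigenvectors T c y -> inner (adj T x) y = 0).
Proof.
move=> red x xc; split=> y [b cb Py]; have [h1 h2 _] := red b cb y Py.
  by rewrite adjP; apply: xc; exists b.
by rewrite adjP adjK; apply: xc; exists b.
Qed.

(** The complement L of the eigenspaces above c reduces T, and |Tx|^2 <= c |x|^2 there, so the
    eigenspace of c consists of maximal vectors and is T-invariant. As c > m, it is also finite
    dimensional and [eigenspace_adj] applies. *)
Lemma reducing_step (c : R) : m < c ->
  (forall b, c < b -> reducing_eigenvalue b) -> reducing_eigenvalue c.
Proof.
move=> mc red.
have c0 : 0 < c by exact: le_lt_trans mc.
have [L LP] := orthogonal_csub (above_eigenvectors T c).
have TL y : y \in L -> T y \in L.
  by move=> /LP/(below_reducing red)[h _]; exact/LP.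
have TaL y : y \in L -> adj T y \in L.
  by move=> /LP/(below_reducing red)[_ h]; exact/LP.
have Tc y : y \in L -> rnorm (T y) ^+ 2 <= c * rnorm y ^+ 2.
  by move=> /LP; apply: op_below => //; exact: ltW.
pose N := null_space (P - c%:C *: bop_id V).
have NP x : x \in N <-> P x = c%:C *: x.
  split=> [/null_spaceP/eqP|Px]; first by rewrite gram_shiftE subr_eq0 => /eqP.
  by apply/null_spaceP; rewrite gram_shiftE Px subrr.
have NL x : P x = c%:C *: x -> x \in L.
  move=> Px; apply/LP => y [b cb Py]; apply: (eigen_orthogonal Px Py).
  by rewrite lt_eqF.
have TN x : x \in N -> T x \in N.
  move=> /NP Px; apply/NP.
  by apply: (max_eigenspace_invariant Tsp (ltW c0) TL TaL Tc) => //; exact: NL.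
have [L' [K [L'P KP [G GP]]]] := top_subspace Tam mup.
have NG x : x \in N -> perp G x -> x = 0.
  move=> /NP Px; apply: GP; apply/KP => y /L'P yL'.
  by apply: inner0C; apply: yL'; exists c.
move=> x Px; have xN : x \in N by apply/NP.
have [h1 h2] := eigenspace_adj c0 NG (fun y yN => (NP y).1 yN) TN xN.
by split=> //; [apply/NP/TN|apply/NP].
Qed.

Lemma above_reducing (b : R) : m < b -> reducing_eigenvalue b.
Proof.
have [n [a [ainj aP]]] := eigenvalue_list Tam mup.
have triv c : m < c -> ~ (exists i, a i = c) -> reducing_eigenvalue c.
  move=> mc nc x Px; have [->|x0] := eqVneq x 0.
    by rewrite !bop0E scaler0.
  by exfalso; apply: nc; apply/aP; split=> //; exists x.
(* Induction on the number of eigenvalues larger than a i. *)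
have good k i : (#|[set j | (a i < a j)%R]%SET| < k)%N -> reducing_eigenvalue (a i).
  elim: k i => [//|k IH] i ik.
  have mi : m < a i by have [] : eigenvalue_above T m (a i) by apply/aP; exists i.
  apply: reducing_step => // c ic.
  have [[j jc]|nc] := pselect (exists j, a j = c); last exact: triv (lt_trans mi ic) nc.
  rewrite -jc in ic *; apply: IH; rewrite -ltnS (leq_trans _ ik)// ltnS proper_card//.
  apply/properP; split.
    by apply/fintype.subsetP => l; rewrite !finset.inE; exact: lt_trans.
  by exists j; rewrite finset.inE ?ltxx.
move=> mb; have [[i <-]|nb] := pselect (exists i, a i = b); last exact: triv.
exact: (good _ i (ltnSn _)).
Qed.

End TopPart.

(** * The spectrum of |T| above the essential spectrum *)

Section AbsSpectrum.
Variables (R : realType) (V : hilbertType R) (T : bop V V).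
Implicit Types (x y : V) (F G : seq V) (L : csubspace V).
Hypothesis Tam : absolutely_min_attaining T.
Variable m : R.
Hypothesis m0 : 0 <= m.
Hypothesis mup : upper_ess T m.

Local Notation P := (adj T ∘ T).
Local Notation S := (abs_bop T).
Local Notation l := (Num.sqrt m).

(** For c > 0, v = Sx - cx satisfies (S + c) v = 0 with S >= 0, so v = 0; for c = 0, |Sx|^2 = <Px,
    x>. *)
Lemma abs_eigen (c : R) x : 0 <= c ->
  S x = c%:C *: x <-> P x = (c ^+ 2)%:C *: x.
Proof.
move=> c0; split=> [Sx|Px].
  by rewrite -abs_sqr Sx bopZ Sx scalerA -rmorphM -expr2.
have [cz|cz] := eqVneq c 0.
  rewrite cz scale0r; apply/eqP.
  by rewrite -rnorm_eq0 -sqrf_eq0 -rdotxx abs_sym abs_sqr Px cz expr0n scale0r rdot0r.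
have cp : 0 < c by rewrite lt_neqAle eq_sym cz.
apply/eqP; rewrite -subr_eq0 -rnorm_eq0; set v := S x - _.
have vE : S v + c%:C *: v = 0.
  rewrite /v bopB bopZ abs_sqr Px scalerBr scalerA -rmorphM -expr2.
  by rewrite addrA subrK subrr.
have : rdot (S v + c%:C *: v) v = 0 by rewrite vE rdot0l.
rewrite rdotDl rdotZl rdotxx => h.
have h1 := abs_ge0 T v.
have h2 : c * rnorm v ^+ 2 <= 0 by lra.
by rewrite -sqrf_eq0 eq_le sqr_ge0 andbT -(pmulr_rle0 _ cp).
Qed.

Lemma abs_null (c : R) x : 0 <= c ->
  x \in null_space (S - c%:C *: bop_id V) <-> P x = (c ^+ 2)%:C *: x.
Proof.
move=> c0; split=> [/null_spaceP/eqP|/(abs_eigen _ c0) Sx].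
  by rewrite subr_eq0 => /eqP; exact: (abs_eigen _ c0).1.
apply/null_spaceP; change (S x - c%:C *: x = 0); rewrite Sx.
exact: subrr.
Qed.

Lemma finite_lower_bound n (f : 'I_n -> R) (d : R) : 0 < d -> (forall i, 0 < f i) ->
  exists e, [/\ 0 < e, e <= d & forall i, e <= f i].
Proof.
(* The reciprocal of a sum of reciprocals is at most each term, and the family may be empty. *)
move=> d0 f0; pose s := d^-1 + \sum_i (f i)^-1.
have sum0 : 0 <= \sum_i (f i)^-1 by apply: sumr_ge0 => i _; rewrite invr_ge0 ltW.
have s0 : 0 < s by rewrite ltr_pwDl// invr_gt0.
exists s^-1; split; first by rewrite invr_gt0.
  by rewrite -[leRHS]invrK lef_pV2 ?posrE ?invr_gt0// lerDl.
move=> i; rewrite -[leRHS]invrK lef_pV2 ?posrE ?invr_gt0//.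
rewrite /s (bigD1 i)//= addrCA lerDl addr_ge0//; first by rewrite invr_ge0 ltW.
by apply: sumr_ge0 => j _; rewrite invr_ge0 ltW.
Qed.

Lemma rnorm_below x : (forall y, above_eigenvectors T m y -> inner x y = 0) ->
  rnorm (T x) <= l * rnorm x.
Proof.
move=> /(op_below Tam m0) h.
rewrite -(@ler_pXn2r _ 2)// ?nnegrE ?mulr_ge0 ?sqrtr_ge0 ?rnorm_ge0//.
by rewrite exprMn sqr_sqrtr.
Qed.

(** S - r is bounded below by |sqrt (a i) - r| on each eigenspace above m and by r - l on L; images
    of these orthogonal pieces stay orthogonal. Being symmetric, it also has dense range. *)
Lemma abs_resolvent (r : R) : l < r -> ~ eigenvalue_above T m (r ^+ 2) ->
  exists Q : bop V V, (S - r%:C *: bop_id V) ∘ Q = bop_id V /\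
    Q ∘ (S - r%:C *: bop_id V) = bop_id V.
Proof.
move=> lr nr; have l0 : 0 <= l by exact: sqrtr_ge0.
have r0 : 0 < r by exact: le_lt_trans lr.
have mr : m < r ^+ 2 by rewrite -(sqr_sqrtr m0) ltrXn2r// ?nnegrE// ltW.
have [n [a [ainj aP]]] := eigenvalue_list Tam mup.
have [L [K [LP KP _]]] := top_subspace Tam mup.
have decomp := top_decomposition ainj aP LP KP.
have am i : m < a i by have /aP[] : exists j, a j = a i by exists i.
pose f i := `|Num.sqrt (a i) - r|.
have f0 i : 0 < f i.
  rewrite normr_gt0 subr_eq0; apply/eqP => h; apply: nr; apply/aP; exists i.
  by rewrite -h sqr_sqrtr// ltW// (le_lt_trans m0).
have d0 : 0 < r - l by rewrite subr_gt0.
have [d [dp dl df]] := finite_lower_bound d0 f0.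
have SE x : (S - r%:C *: bop_id V) x = S x - r%:C *: x by [].
have Ssym : symmetric_bop (S - r%:C *: bop_id V).
  by move=> x y; rewrite !SE rdotBl rdotBr rdotZl rdotZr abs_sym.
have below x : d * rnorm x <= rnorm ((S - r%:C *: bop_id V) x).
  have [p [pL pP]] := projection L x.
  have /decomp[v vP vE] : x - p \in K.
    by apply/KP => y yL; apply: (csub_rdot_inner pP).
  have -> : x = \sum_i v i + p by rewrite -vE subrK.
  have Sv i : S (v i) = (Num.sqrt (a i))%:C *: v i.
    apply/abs_eigen; first exact: sqrtr_ge0.
    by rewrite sqr_sqrtr// ltW// (le_lt_trans m0).
  have vabove i : above_eigenvectors T m (v i) by exists (a i).
  have vo i j : i != j -> rdot (v i) (v j) = 0.
    move=> ij; apply/inner0_rdot/(eigen_orthogonal (vP i) (vP j)).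
    by rewrite (inj_eq ainj).
  have vp i : rdot (v i) p = 0.
    by apply/inner0_rdot/inner0C; move/LP : pL; apply.
  have vSp i : rdot (v i) (S p - r%:C *: p) = 0.
    by rewrite rdotBr rdotZr -abs_sym Sv rdotZl !vp !mulr0 subrr.
  have -> : (S - r%:C *: bop_id V) (\sum_i v i + p) =
      \sum_i (Num.sqrt (a i) - r)%:C *: v i + (S p - r%:C *: p).
    rewrite bopD 2!SE bop_sum scaler_sumr -sumrB; congr (_ + _).
    by apply: eq_bigr => i _; rewrite Sv rmorphB scalerBl.
  have pp : d * rnorm p <= rnorm (S p - r%:C *: p).
    have h1 : rnorm (S p) <= l * rnorm p by rewrite rnorm_abs; apply: rnorm_below; exact/LP.
    have h2 := rnormD (S p) (r%:C *: p - S p).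
    rewrite addrC subrK rnormZR ?(ltW r0)// rnormB in h2.
    apply: (@le_trans _ _ ((r - l) * rnorm p)); first by rewrite ler_wpM2r ?rnorm_ge0.
    by rewrite mulrBl; lra.
  rewrite -(@ler_pXn2r _ 2)// ?nnegrE ?mulr_ge0 ?rnorm_ge0 ?(ltW dp)//.
  have e1 : rdot (\sum_i v i) p = 0 by rewrite rdot_suml big1.
  have e2 : rdot (\sum_i (Num.sqrt (a i) - r)%:C *: v i) (S p - r%:C *: p) = 0.
    by rewrite rdot_suml big1// => i _; rewrite rdotZl vSp mulr0.
  rewrite exprMn (rnormD2 _ p) (rnormD2 _ (S p - r%:C *: p)) e1 e2.
  rewrite pythagoras// pythagoras => [|i j ij]; last by rewrite rdotZl rdotZr vo// !mulr0.
  rewrite !mulr0 !addr0 mulrDr mulr_sumr lerD//; last first.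
    by rewrite -exprMn lerXn2r ?nnegrE ?mulr_ge0 ?rnorm_ge0 ?(ltW dp).
  apply: ler_sum => i _; rewrite rnormZ normc_def /= expr0n addr0 sqrtr_sqr.
  by rewrite exprMn ler_wpM2r ?sqr_ge0// lerXn2r ?nnegrE ?(ltW dp) ?df.
apply: (bounded_below_inverse dp below) => z hz.
have Sz : (S - r%:C *: bop_id V) z = 0.
  by apply: rnorm0_rdot => y; rewrite Ssym rdotC.
apply/eqP; rewrite -rnorm_eq0 eq_le rnorm_ge0 andbT -(pmulr_rle0 _ dp).
by rewrite (le_trans (below z))// Sz rnorm0.
Qed.

Lemma abs_eigen_spectrum (r : R) : 0 <= r -> eigenvalue_above T m (r ^+ 2) ->
  spectrum S r%:C /\ r <= opnorm T.
Proof.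
move=> r0 [_ [y y0 Py]]; have /(abs_eigen _ r0) Sy := Py; split.
  move=> [Q [_ /bopP/(_ y)]]; change (Q (S y - r%:C *: y) = y -> False).
  by rewrite Sy subrr bop0E => /esym/eqP; rewrite (negbTE y0).
have [M M0 TM] := bop_gt0_bounded T.
apply: ub_le_sup.
  exists M => _ [x /= x1 <-]; rewrite (le_trans (TM x))//.
  by rewrite ler_piMr// ltW.
exists ((rnorm y)^-1%:C *: y); first by rewrite /= unit_scale.
rewrite bopZ rnormZR ?invr_ge0 ?rnorm_ge0// -rnorm_abs Sy rnormZR//.
by rewrite mulrCA mulVf ?mulr1// rnorm_eq0.
Qed.

Lemma abs_spectrum_top n (a : 'I_n -> R) :
  (forall b, eigenvalue_above T m b <-> exists i, a i = b) ->
  `]l, opnorm T] `&` [set r | spectrum S r%:C] = range (fun i => Num.sqrt (a i)).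
Proof.
move=> aP; have l0 : 0 <= l by exact: sqrtr_ge0.
apply/seteqP; split=> [r [] /=|_ [i _ <-]].
  rewrite in_itv /= => /andP[lr _] rS.
  have r0 : 0 < r by exact: le_lt_trans lr.
  have /aP[i ai] : eigenvalue_above T m (r ^+ 2).
    by apply: contrapT => /(abs_resolvent lr).
  by exists i => //; rewrite ai sqrtr_sqr gtr0_norm.
have ea : eigenvalue_above T m (a i) by apply/aP; exists i.
have mi : m < a i by case: ea.
have ai0 : 0 < a i by exact: le_lt_trans mi.
have [] := @abs_eigen_spectrum (Num.sqrt (a i)); first exact: sqrtr_ge0.
  by rewrite sqr_sqrtr ?ltW.
move=> h1 h2; split=> //=; rewrite in_itv /= h2 andbT.
by rewrite ltr_sqrt.
Qed.

End AbsSpectrum.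

Section Blocks.
Variables (R : realType) (H : hilbertType R) (T : bop H H).
Hypothesis Tam : absolutely_min_attaining T.
Hypothesis Tsp : star_paranormal T.
Variable m : R.
Hypothesis m0 : 0 <= m.
Hypothesis mup : upper_ess T m.

Local Notation P := (adj T ∘ T).
Local Notation S := (abs_bop T).
Local Notation l := (Num.sqrt m).

Variables L H0 : csubspace H.
Hypothesis LP : forall x, x \in L <->
  forall y, above_eigenvectors T m y -> inner x y = 0.
Hypothesis H0P : forall x, x \in H0 <-> forall y, y \in L -> inner x y = 0.

Local Notation H1 := (null_space (S - l%:C *: bop_id H)).

Lemma H1_gram x : x \in H1 <-> P x = m%:C *: x.
Proof. by rewrite abs_null ?sqrtr_ge0// sqr_sqrtr. Qed.

Lemma H1_below x : x \in H1 -> x \in L.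
Proof.
move=> /H1_gram Px; apply/LP => y [b mb Py].
by apply: (eigen_orthogonal Px Py); rewrite lt_eqF.
Qed.

Lemma below_reducing_op x : x \in L -> T x \in L /\ adj T x \in L.
Proof.
move=> /LP xL.
have [h1 h2] := below_reducing (above_reducing Tam Tsp m0 mup) xL.
by split; apply/LP.
Qed.

Lemma top_reducing x : x \in H0 -> T x \in H0 /\ adj T x \in H0.
Proof.
move=> /H0P xH; split; apply/H0P => y /below_reducing_op[h1 h2].
  by rewrite adjP; exact: xH.
by rewrite adjP adjK; exact: xH.
Qed.

(** The maximal vector argument with c = m on L. H1 may be infinite dimensional, so surjectivity and
    invariance under the adjoint do not follow as they do above m. *)
Lemma H1_invariant x : x \in H1 -> T x \in H1.
Proof.
move=> xH; apply/H1_gram; apply: (max_eigenspace_invariant (L := L) Tsp m0).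
- by move=> y /below_reducing_op[].
- by move=> y /below_reducing_op[].
- by move=> y /LP; exact: (op_below Tam).
- exact: H1_below.
- exact/H1_gram.
Qed.

Lemma top_normal x : x \in H0 -> T (adj T x) = P x.
Proof.
have [n [a [ainj aP]]] := eigenvalue_list Tam mup.
move=> /(top_decomposition ainj aP LP H0P)[v vP ->].
change (T (adj T (\sum_i v i)) = adj T (T (\sum_i v i))).
rewrite !bop_sum; apply: eq_bigr => i _.
have mi : m < a i by have /aP[] : exists j, a j = a i by exists i.
have [_ _ ->] := above_reducing Tam Tsp m0 mup mi (vP i).
by rewrite -[RHS]/(P (v i)) vP.
Qed.

Lemma isometric_block : exists V : bop (subhilb H1) (subhilb H1),
  (forall x, l%:C *: val (V x) = T (val x)) /\ isometry_bop V.
Proof.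
have nT (x : subhilb H1) : rnorm (T (val x)) = l * rnorm x.
  have /(abs_eigen _ _ (sqrtr_ge0 m)) : P (val x) = (l ^+ 2)%:C *: val x.
    by rewrite sqr_sqrtr//; exact/H1_gram/valP.
  by move=> Sx; rewrite -rnorm_abs Sx rnormZR ?sqrtr_ge0.
have [lz|lz] := eqVneq l 0.
  (* For l = 0, T vanishes on H1 and l V = T puts no condition on V, so any isometry will do. *)
  exists (bop_id (subhilb H1)); split=> [x|//].
  have -> : T (val x) = 0.
    by apply/eqP; rewrite -rnorm_eq0 nT; move: (rnorm x) => c; rewrite lz mul0r.
  by change (l%:C *: val x = 0); move: (val x) => z; rewrite lz scale0r.
have lp : 0 < l by rewrite lt_neqAle eq_sym lz sqrtr_ge0.
have [V VP] : exists V : bop (subhilb H1) (subhilb H1),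
    forall x, val (V x) = (l^-1)%:C *: T (val x).
  apply: (restriction (S := (l^-1)%:C *: T)) => x xH.
  by change ((l^-1)%:C *: T x \in H1); rewrite rpredZ// H1_invariant.
exists V; split=> x.
  by rewrite VP scalerA -rmorphM mulfV// scale1r.
rewrite rnorm_subhilb VP rnormZR ?invr_ge0 ?sqrtr_ge0// nT mulrA mulVf//.
by rewrite mul1r.
Qed.

(** U is T / sqrt b; since the eigenspace reduces T, the adjoint of U is [adj T] / sqrt b. *)
Lemma unitary_block (b : R) : m < b ->
  exists U : bop (subhilb (null_space (S - (Num.sqrt b)%:C *: bop_id H)))
                 (subhilb (null_space (S - (Num.sqrt b)%:C *: bop_id H))),
  (forall x, (Num.sqrt b)%:C *: val (U x) = T (val x)) /\ unitary_bop U.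
Proof.
move=> mb; set N := null_space _.
have b0 : 0 < b by exact: le_lt_trans mb.
pose s := Num.sqrt b; have s0 : 0 < s by rewrite sqrtr_gt0.
have ss : s ^+ 2 = b by rewrite sqr_sqrtr// ltW.
have NP x : x \in N <-> P x = b%:C *: x.
  by rewrite /N abs_null ?(ltW s0)// -/s ss.
have red := above_reducing Tam Tsp m0 mup mb.
have [U UP] : exists U : bop (subhilb N) (subhilb N),
    forall x, val (U x) = (s^-1)%:C *: T (val x).
  apply: (restriction (S := (s^-1)%:C *: T)) => x /NP/red[h _ _].
  by change ((s^-1)%:C *: T x \in N); rewrite rpredZ//; exact/NP.
have [U' U'P] : exists U : bop (subhilb N) (subhilb N),
    forall x, val (U x) = (s^-1)%:C *: adj T (val x).
  apply: (restriction (S := (s^-1)%:C *: adj T)) => x /NP/red[_ h _].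
  by change ((s^-1)%:C *: adj T x \in N); rewrite rpredZ//; exact/NP.
have aU : adj U = U'.
  apply: adj_unique => x y; rewrite !rdot_subhilb UP U'P rdotZl rdotZr.
  by rewrite rdot_adj.
have sb : (s^-1)%:C * (s^-1)%:C * b%:C = 1.
  rewrite -!rmorphM -ss (_ : s^-1 * s^-1 * s ^+ 2 = 1) ?rmorph1//.
  by field; rewrite gt_eqF.
exists U; split=> [x|].
  by rewrite UP scalerA -rmorphM mulfV ?gt_eqF// scale1r.
rewrite /unitary_bop aU; split; apply/bopP => x; apply: val_inj.
  change (val (U' (U x)) = val x); rewrite U'P UP bopZ scalerA.
  have /NP : val x \in N by exact: valP.
  by move=> /= ->; rewrite scalerA sb scale1r.
change (val (U (U' x)) = val x); rewrite UP U'P bopZ scalerA.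
have /NP/red[_ _ ->] : val x \in N by exact: valP.
by rewrite scalerA sb scale1r.
Qed.

End Blocks.

(** * Assembly of the decomposition *)

Theorem theorem2p14 (R : realType) (H : hilbertType R) (T : bop H H) :
  ~ finite_dimensional [set: H] ->
  absolutely_min_attaining T ->
  star_paranormal T ->
  exists (lambda : R) (n : nat) (alpha : 'I_n -> R) (H0 H1 H2 : csubspace H),
  let absT := abs_bop T in
  let N (i : 'I_n) := null_space (absT - (alpha i)%:C *: bop_id H) in
  exists (V0 : bop (subhilb H0) (subhilb H0))
    (U : forall i, bop (subhilb (N i)) (subhilb (N i)))
    (V : bop (subhilb H1) (subhilb H1))
    (A : bop (subhilb H2) (subhilb H1))
    (B : bop (subhilb H2) (subhilb H2)),
  (is_dsum3 H0 H1 H2 /\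
   block3 T V0 0              0
            0  (lambda%:C *: V) A
            0  0              B) /\
  (ess_spectrum absT = [set lambda%:C] /\ 0 <= lambda) /\
  [/\ injective alpha,
      `]lambda, opnorm T] `&` [set r | spectrum absT r%:C] = range alpha,
      is_dsum N H0 /\ finite_dimensional [set` H0],
      H1 = null_space (absT - lambda%:C *: bop_id H) &
      forall x, x \in H2 <->
        forall x0 x1, x0 \in H0 -> x1 \in H1 -> inner x (x0 + x1) = 0] /\
  [/\ is_dsum_bop (fun i => (alpha i)%:C *: U i) V0,
      forall i, unitary_bop (U i),
      finite_rank V0 &
      normal_bop V0] /\
  [/\ (exists x1 : subhilb H1, x1 != 0) -> isometry_bop V,
      adj V ∘ A = 0,
      bop_le (adj A ∘ A + adj B ∘ B)
             ((lambda ^+ 2)%:C *: bop_id (subhilb H2)) &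
      forall k : R, 0 < k ->
        positive_bop ((lambda ^+ 4 + k ^+ 2)%:C *: bop_id (subhilb H2)
                      - (2 * k)%:C *: (B ∘ adj B))].
Proof.
move=> infH Tam Tsp.
have [m [m0 mlow mhigh]] := lower_ess_sup T infH.
have mup := am_upper_ess Tam mhigh.
have [n [a [ainj aP]]] := eigenvalue_list Tam mup.
have [L [H0 [LP H0P [G GP]]]] := top_subspace Tam mup.
have am i : m < a i by have /aP[] : exists j, a j = a i by exists i.
have a0 i : 0 <= a i by rewrite ltW// (le_lt_trans m0).
pose l := Num.sqrt m; have l0 : 0 <= l by exact: sqrtr_ge0.
pose H1 := null_space (abs_bop T - l%:C *: bop_id H).
have [H2 H2P] : exists H2 : csubspace H, forall x, x \in H2 <->
    forall x0 x1, x0 \in H0 -> x1 \in H1 -> inner x (x0 + x1) = 0.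
  have [H2 H2P] := orthogonal_csub
    [set z | exists x0 x1, [/\ x0 \in H0, x1 \in H1 & z = x0 + x1]].
  exists H2 => x; split=> [/H2P h x0 x1 h0 h1|h].
    by apply: h; exists x0, x1.
  by apply/H2P => _ [x0 [x1 [h0 h1 ->]]]; exact: h.
have H1L x : x \in H1 -> x \in L by exact: H1_below.
have H02 x y : x \in H2 -> y \in H0 -> inner x y = 0.
  by move=> /H2P h yH; have := h y 0 yH (rpred0 _); rewrite addr0.
have H12 x y : x \in H2 -> y \in H1 -> inner x y = 0.
  by move=> /H2P h yH; have := h 0 y (rpred0 _) yH; rewrite add0r.
have H2I x : x \in L -> (forall y, y \in H1 -> inner x y = 0) -> x \in H2.
  move=> xL xH1; apply/H2P => x0 x1 h0 h1; rewrite linearDr /= (xH1 x1)// addr0.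
  by apply: inner0C; move/H0P : h0; exact.
have decomp x : exists (x0 : subhilb H0) (x1 : subhilb H1) (x2 : subhilb H2),
    x = val x0 + val x1 + val x2.
  have [p [pL pP]] := projection L x.
  have [q [qH qP]] := projection H1 p.
  have x0H : x - p \in H0 by apply/H0P => y; exact: (csub_rdot_inner pP).
  have x2H : p - q \in H2.
    by apply: H2I; [rewrite rpredB// H1L|exact: (csub_rdot_inner qP)].
  exists (SubHilb x0H), (SubHilb qH), (SubHilb x2H) => /=.
  by rewrite -addrA [q + _]addrC subrK subrK.
have H2L x : x \in H2 -> x \in L.
  move=> xH; apply/LP => y [b mb Py]; apply: H02 => //.
  by apply/H0P => z /LP zL; apply: inner0C; apply: zL; exists b.
have top := top_reducing Tam Tsp m0 mup LP H0P.
have low := below_reducing_op Tam Tsp m0 mup LP.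
have [V0 V0P] : exists V0 : bop (subhilb H0) (subhilb H0),
    forall x, val (V0 x) = T (val x).
  by apply: restriction => x /top[].
have [V0' V0'P] : exists V0 : bop (subhilb H0) (subhilb H0),
    forall x, val (V0 x) = adj T (val x).
  by apply: restriction => x /top[].
have [V [VP Viso]] := isometric_block Tam Tsp m0 mup LP.
have [A AP] := compression H2 H1 T.
have [B BP] := compression H2 H2 T.
pose U i := projT1 (cid (unitary_block Tam Tsp m0 mup (am i))).
have UP i : (forall x, (Num.sqrt (a i))%:C *: val (U i x) = T (val x)) /\
    unitary_bop (U i).
  by rewrite /U; case: cid.
(* T x stays in L and so has no component in H0; its other two components are the compressions A x
   and B x. *)
have TH2 (x : subhilb H2) : T (val x) = val (A x) + val (B x).
  apply/eqP; rewrite -subr_eq0; apply/eqP/rnorm0_rdot => z.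
  have [z0 [z1 [z2 ->]]] := decomp z.
  rewrite !rdotDr !rdotBl !rdotDl AP BP.
  have Tx : inner (T (val x)) (val z0) = 0.
    apply: inner0C; have /H0P := valP z0; apply.
    by have [] := low _ (H2L _ (valP x)).
  have A0 : inner (val (A x)) (val z0) = 0.
    by apply: inner0C; have /H0P := valP z0; apply; exact/H1L/valP.
  have B0 : inner (val (B x)) (val z0) = 0 by exact: H02 (valP _) (valP _).
  have B1 : inner (val (B x)) (val z1) = 0 by exact: H12 (valP _) (valP _).
  have A2 : inner (val (A x)) (val z2) = 0.
    by apply: inner0C; exact: H12 (valP _) (valP _).
  rewrite !(inner0_rdot Tx, inner0_rdot A0, inner0_rdot B0, inner0_rdot B1,
    inner0_rdot A2); lra.
have nT2 (x : subhilb H2) : rnorm (T (val x)) ^+ 2 = rnorm (A x) ^+ 2 + rnorm (B x) ^+ 2.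
  rewrite TH2 rnormD2.
  rewrite rdotC (inner0_rdot (H12 _ _ (valP (B x)) (valP (A x)))).
  by rewrite mulr0 addr0.
have TlH2 x : x \in L -> rnorm (T x) <= l * rnorm x.
  by move=> /LP; exact: (rnorm_below Tam m0).
exists l, n, (fun i => Num.sqrt (a i)), H0, H1, H2 => absT N.
have NP i x : x \in N i <-> adj T (T x) = (a i)%:C *: x.
  by rewrite /N /absT abs_null ?sqrtr_ge0// sqr_sqrtr.
exists V0, U, V, A, B; split; last split; last split; last split.
- split.
    split=> //.
    + by move=> x y xH yH; apply: (H0P x).1 => //; exact: H1L.
    + by move=> x y xH yH; exact/inner0C/H02.
    + by move=> x y xH yH; exact/inner0C/H12.
  move=> x0 x1 x2; rewrite !bopD TH2 -V0P -VP !val_subhilbD.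
  rewrite !val_subhilb0 val_subhilbZ !addr0 !add0r -!addrA; do 3!congr (_ + _).
- by split=> //; exact: ess_spectrum_abs.
- split=> //.
  + move=> i j /eqP; rewrite -(@eqrXn2 _ 2)// ?sqrtr_ge0// !sqr_sqrtr//.
    by move=> /eqP/ainj.
  + exact: abs_spectrum_top.
  + split; last exact: finite_dimensional_of_perp0 GP.
    split=> [i j ij x y /= /NP Px /NP Py|].
      by apply: (eigen_orthogonal Px Py); rewrite (inj_eq ainj).
    apply/seteqP; split=> x /=.
      move=> /(top_decomposition ainj aP LP H0P)[v vP ->].
      have vN i : v i \in N i by apply/NP; exact: vP.
      by exists (fun i => SubHilb (vN i)).
    move=> [v _ <-]; apply/(top_decomposition ainj aP LP H0P).
    exists (fun i => val (v i)) => // i; apply/NP; exact: valP.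
- split.
  + move=> x y yE; rewrite V0P yE bop_sum; apply: eq_bigr => i _.
    by have [<- _] := UP i.
  + by move=> i; have [] := UP i.
  + exact/finite_rank_subhilb/(finite_dimensional_of_perp0 GP).
  + have aV0 : adj V0 = V0'.
      by apply: adj_unique => x y; rewrite !rdot_subhilb V0P V0'P rdot_adj.
    apply/bopP => x; apply: val_inj; rewrite aV0.
    change (val (V0' (V0 x)) = val (V0 (V0' x))).
    by rewrite V0'P !V0P V0'P (top_normal Tam Tsp m0 mup LP H0P (valP x)).
- split=> //.
  + apply/bopP => x; change (adj V (A x) = 0).
    apply: rnorm0_rdot => y; rewrite rdot_adjl.
    (* If l = 0, T vanishes on L, so A x = 0. Otherwise <Tx, Ty> = <x, Py> = m <x, y> = 0 for y in
       H1; T y is in H1, so only A x contributes, and T y = l V y can be divided by l. *)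
    have [lz|lz] := eqVneq l 0.
      have Tx0 : rnorm (T (val x)) ^+ 2 = 0.
        have := TlH2 _ (H2L _ (valP x)); rewrite lz mul0r => h.
        by have /eqP -> : rnorm (T (val x)) == 0; [rewrite eq_le h rnorm_ge0|rewrite expr0n].
      have : rnorm (A x) = 0.
        apply/eqP; rewrite -sqrf_eq0 eq_le sqr_ge0 andbT.
        by rewrite -Tx0 nT2 lerDl sqr_ge0.
      by move/eqP; rewrite rnorm_eq0 => /eqP ->; rewrite rdot0l.
    have h : rdot (T (val x)) (T (val y)) = 0.
      rewrite -rdot_gram gram_sym.
      have /(H1_gram T m0) -> : val y \in H1 by exact: valP.
      by rewrite rdotZr (inner0_rdot (H12 _ _ (valP x) (valP y))) mulr0.
    have TyH : T (val y) \in H1 by rewrite -VP rpredZ//; exact: valP.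
    have h2 : rdot (val (A x)) (T (val y)) = 0.
      by rewrite -h TH2 rdotDl (inner0_rdot (H12 _ _ (valP (B x)) TyH)) addr0.
    move: h2; rewrite -VP rdotZr => /eqP; rewrite mulf_eq0 (negbTE lz) /=.
    by move/eqP.
  + have DE (x y : subhilb H2) :
        rdot (((l ^+ 2)%:C *: bop_id (subhilb H2) - (adj A ∘ A + adj B ∘ B)) x) y
        = l ^+ 2 * rdot x y - (rdot (A x) (A y) + rdot (B x) (B y)).
      change (rdot ((l ^+ 2)%:C *: x - (adj A (A x) + adj B (B x))) y =
        l ^+ 2 * rdot x y - (rdot (A x) (A y) + rdot (B x) (B y))).
      by rewrite rdotBl rdotZl rdotDl !rdot_adjl.
    apply/positive_bopP; split=> [x y|x].
      by rewrite DE [RHS]rdotC DE (rdotC x) (rdotC (A x)) (rdotC (B x)).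
    rewrite DE !rdotxx -nT2 subr_ge0 -exprMn.
    rewrite lerXn2r ?nnegrE ?mulr_ge0 ?rnorm_ge0//.
    exact/TlH2/H2L/valP.
  + move=> k k0.
    have DE (x y : subhilb H2) :
        rdot (((l ^+ 4 + k ^+ 2)%:C *: bop_id (subhilb H2)
               - (2 * k)%:C *: (B ∘ adj B)) x) y
        = (l ^+ 4 + k ^+ 2) * rdot x y - 2 * k * rdot (adj B x) (adj B y).
      change (rdot ((l ^+ 4 + k ^+ 2)%:C *: x - (2 * k)%:C *: (B (adj B x))) y =
        (l ^+ 4 + k ^+ 2) * rdot x y - 2 * k * rdot (adj B x) (adj B y)).
      by rewrite rdotBl !rdotZl (rdot_adj B).
    apply/positive_bopP; split=> [x y|x].
      by rewrite DE [RHS]rdotC DE (rdotC x) (rdotC (adj B x)).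
    (* [adj B] is the compression of [adj T]: <adj B x, adj B x> = <x, T (adj B x)> = <adj T x, adj
       B x>. *)
    have Bx : rnorm (adj B x) <= rnorm (adj T (val x)).
      have [->|w0] := eqVneq (adj B x) 0; first by rewrite rnorm0 rnorm_ge0.
      rewrite -(ler_pM2l (_ : 0 < rnorm (adj B x))) ?rnorm_gt0//.
      rewrite -expr2 -rdotxx -rdot_adj rdot_subhilb BP rdot_adj.
      exact: rdot_le.
    (* *-paranormality at x, with |T| <= l used twice because T x is again in L. *)
    have Tx : rnorm (adj T (val x)) ^+ 2 <= l ^+ 2 * rnorm x ^+ 2.
      have xL := H2L _ (valP x); have [TxL _] := low _ xL.
      have h1 := TlH2 _ xL; have h2 := TlH2 _ TxL.
      apply: (le_trans (Tsp (val x))).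
      rewrite (expr2 (rnorm x)) mulrA ler_wpM2r ?rnorm_ge0// (le_trans h2)//.
      by rewrite expr2 -mulrA ler_wpM2l.
    have Bx2 : rnorm (adj B x) ^+ 2 <= l ^+ 2 * rnorm x ^+ 2.
      by apply: le_trans Tx; rewrite lerXn2r ?nnegrE ?rnorm_ge0.
    rewrite DE !rdotxx.
    have h := ler_wpM2l (ltW k0) Bx2.
    have h' : 0 <= (l ^+ 2 - k) ^+ 2 * rnorm x ^+ 2 by rewrite mulr_ge0 ?sqr_ge0.
    have -> : (l ^+ 4 + k ^+ 2) * rnorm x ^+ 2 - 2 * k * rnorm (adj B x) ^+ 2 =
      (l ^+ 2 - k) ^+ 2 * rnorm x ^+ 2 +
      2 * (k * (l ^+ 2 * rnorm x ^+ 2) - k * rnorm (adj B x) ^+ 2) by ring.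
    by rewrite addr_ge0// mulr_ge0// subr_ge0.
Qed.
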